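(* Let $c_*$ denote the least possible absolute constant $c$ such that $$\mathsf P(S_n\ge x)\le c\,\mathsf P(Z\ge x)\qquad\text{for all }x\in\mathbb R,$$ for all $n\in\{1,2,\dots\}$ and all real numbers $a_1,\dots,a_n$ with $a_1^2+\dots+a_n^2=1$, where $S_n:=a_1\varepsilon_1+\dots+a_n\varepsilon_n$. Then $$c_*\in[c_1,c_2],$$ where $$c_1:=\frac1{4\overline{\Phi}(\sqrt2)}\quad\text{and}\quad c_2:=c_1\cdot\Big(1+\tfrac1{250}\big(1+r(\sqrt3\,)\big)\Big);$$ here, numerically, $[c_1,c_2]\approx[3.18,3.22]$ and $c_2\approx c_1\cdot1.01$.
   Context: $\varepsilon_1,\dots,\varepsilon_n$ are independent Rademacher random variables, i.e. $\mathsf P(\varepsilon_i=1)=\mathsf P(\varepsilon_i=-1)=\frac12$ for all $i$. $Z\sim N(0,1)$ is a standard normal random variable. $\varphi(x):=e^{-x^2/2}/\sqrt{2\pi}$ is its density, $\overline{\Phi}(x):=\mathsf P(Z\ge x)=\int_x^\infty\varphi(u)\,du$ its tail function, and $r:=\varphi/\overline{\Phi}$ the inverse Mills ratio. *)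

(* Defs.v *)
From HB Require Import structures.
From mathcomp Require Import all_boot all_order all_algebra.
From mathcomp Require Import all_classical all_reals all_analysis.
Set Implicit Arguments.
Unset Strict Implicit.
Unset Printing Implicit Defensive.
Import Order.TTheory GRing.Theory Num.Theory.
Import numFieldNormedType.Exports.
Local Open Scope classical_set_scope.
Local Open Scope ring_scope.

Definition mutually_independent (R : realType) (d : measure_display)
    (T : measurableType d) (P : probability T R) (n : nat)
    (X : 'I_n -> {RV P >-> R}) : Prop :=
  forall (J : {set 'I_n}) (A : 'I_n -> set R),
    (forall i, i \in J -> measurable (A i)) ->
    P (\bigcap_(i in [set` J]) (X i @^-1` A i))
      = (\prod_(i in J) P (X i @^-1` A i))%E.

Definition rademacher (R : realType) (d : measure_display)
    (T : measurableType d) (P : probability T R) (X : {RV P >-> R}) : Prop :=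
  P (X @^-1` [set 1]) = (2^-1)%:E /\ P (X @^-1` [set -1]) = (2^-1)%:E.

Definition phi (R : realType) (x : R) : R := normal_pdf 0 1 x.

Lemma phiE (R : realType) (x : R) :
  phi x = expR (- (x ^+ 2 / 2)) / Num.sqrt (2 * pi).
Proof.
rewrite /phi normal_pdfE ?oner_neq0// /normal_peak /normal_fun.
by rewrite subr0 expr1n mul1r mulNr mulrC mulr_natl.
Qed.

(* normal_prob 0 1 is the law of Z ~ N(0,1), so this is P(Z >= x). *)
Definition Phibar (R : realType) (x : R) : R :=
  fine (normal_prob 0 1 `[x, +oo[%classic).

Lemma PhibarE (R : realType) (x : R) :
  Phibar x = \int[lebesgue_measure]_(u in `[x, +oo[) phi u.
Proof. by []. Qed.

Definition inv_mills (R : realType) (x : R) : R := phi x / Phibar x.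

(* The probability space carrying the Rademacher variables is arbitrary; the
   law of S_n, hence the condition on c, does not depend on it. *)
Definition dominating_constant (R : realType) (c : R) : Prop :=
  forall (n : nat) (a : 'I_n -> R),
    (0 < n)%N -> \sum_(i < n) a i ^+ 2 = 1 ->
  forall (d : measure_display) (T : measurableType d) (P : probability T R)
    (eps : 'I_n -> {RV P >-> R}),
    mutually_independent eps -> (forall i, rademacher (eps i)) ->
  forall x : R,
    fine (P [set w | x <= \sum_(i < n) a i * eps i w]) <= c * Phibar x.

Definition c1 (R : realType) : R := 1 / (4 * Phibar (Num.sqrt 2)).

Definition c2 (R : realType) : R :=
  c1 R * (1 + 1 / 250 * (1 + inv_mills (Num.sqrt 3))).

(* Main.v *)
Require Import Defs.
From HB Require Import structures.
From mathcomp Require Import all_boot all_order all_algebra.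
From mathcomp Require Import all_classical all_reals all_analysis.
From mathcomp Require Import measurable_realfun.
From mathcomp Require Import ring lra.
Import Order.TTheory GRing.Theory Num.Theory.
Import numFieldNormedType.Exports.
Local Open Scope classical_set_scope.
Local Open Scope ring_scope.

(** The least constant is the infimum of the dominating ones, which is itself
dominating because [Phibar] is positive; so two things are needed: no constant
below [c1] dominates, and [c2] dominates.

Lower bound.  For two fair signs with coefficients 1/sqrt 2, the event that the
sum is at least sqrt 2 is that both signs are positive; its probability 1/4
forces c >= 1 / (4 Phibar(sqrt 2)) = [c1] ([dominating_ge_c1]).

Upper bound.  The tail probability is at most an average over the 2^n sign
patterns ([prob_upper_le]), which does not change when the coefficients are
replaced by their absolute values and sorted.  The inequality
P(S >= x) <= c2 * Phibar(x) is trivial for x <= 0, follows from symmetry for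
0 < x <= 1 and from Chebyshev's bound 1/(2x^2) for 1 <= x <= sqrt 2.  Beyond
sqrt 2 one argues by induction on the number of coefficients, conditioning on
the smallest one, t: with unit sum of squares,

  P(S >= x) = (P(S' >= A) + P(S' >= B)) / 2,
  A = (x - t) / sqrt (1 - t^2),  B = (x + t) / sqrt (1 - t^2),

where S' is again a normalised sum.  The induction closes with a bound c2 * g
for any g satisfying the two-point inequality g(A) + g(B) <= 2 g(x).  Write
s = xt.  Along the curve t -> (A, B), after a change of parameter, the
derivative of g(A) + g(B) is (1 - s) (-g'(A)) - (1 + s) (-g'(B)).  For
g = Phibar the ratio of the two densities is exp(2w) with w = s / (1 - t^2), so
the requirement is w <= artanh s; but w - artanh s is about s t^2 (1 - x^2/3)
for small t, and this is positive for x < sqrt 3.  So Phibar itself fails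
below sqrt 3, and is replaced by [profile], a slightly smaller function which
agrees with Phibar beyond sqrt 3 and whose derivative is -(1 - kappa) phi, where
kappa(u) = (3 - min(u, sqrt 3)^2)^3 / 40 decreases to 0.  The difference
kappa(A) - kappa(B) then pays for the excess of w over artanh s.  The power 3
is chosen because 3 - A^2 and 3 - B^2 are rational in x and t, so that the
comparison becomes a polynomial inequality, and because vanishing to this order
makes kappa smooth enough at sqrt 3; the factor 1/40 is large enough to make the
two-point inequality true ([profile_two_point]) and small enough to keep
Chebyshev's bound below c2 * profile on [27/25, sqrt 2]
([chebyshev_le_profile]), where the induction starts.

For x <= sqrt 3 the two-point inequality is used only when t^2 <= 1/5, which
holds as soon as there are five coefficients, and which also keeps A above
27/25.  With at most four coefficients and sqrt 2 < x <= sqrt 3 a direct count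
of sign patterns gives P(S >= x) <= 1/8 <= c2 * Phibar(sqrt 3)
([sign_tail_le_eighth]).

The constant c2 enters at sqrt 2, where c2 * Phibar(sqrt 2) exceeds the
Chebyshev value 1/4 by (1 + r(sqrt 3)) / 1000; this covers the loss from
replacing Phibar by [profile].  The numerical facts needed about Phibar come
from its alternating Taylor series and rational bounds for pi. *)

(** * Gaussian density and tail *)

Lemma le_of_derive (R : realType) (f df : R -> R) (a b : R) :
  a <= b -> (forall x, a <= x <= b -> is_derive x 1 f (df x)) ->
  (forall x, a < x < b -> 0 <= df x) -> f a <= f b.
Proof.
move=> ab fdf df0; have [<-//|aneb] := eqVneq a b.
have altb : a < b by rewrite lt_neqAle aneb.
have cf : {within `[a, b], continuous f}.
  by apply: derivable_within_continuous => x; rewrite in_itv/= => /fdf[].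
have fdf' x : x \in `]a, b[ -> is_derive x 1 f (df x).
  by rewrite in_itv/= => /andP[ax xb]; apply: fdf; rewrite !ltW.
have [c] := MVT altb fdf' cf.
rewrite in_itv/= => /df0 dfc fE; rewrite -subr_ge0 fE.
by rewrite mulr_ge0// subr_ge0.
Qed.

Section gauss.
Context {R : realType}.
Implicit Types u x : R.

Lemma phi_gt0 u : 0 < phi u.
Proof. by rewrite phiE divr_gt0 ?expR_gt0// sqrtr_gt0 mulr_gt0// pi_gt0. Qed.

Lemma phiN u : phi (- u) = phi u.
Proof. by rewrite !phiE sqrrN. Qed.

Lemma is_derive_phi u : is_derive u 1 (@phi R) (- u * phi u).
Proof.
have -> : @phi R = (fun x => expR (- (x ^+ 2 / 2)) * (Num.sqrt (2 * pi))^-1).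
  by apply/funext => x; rewrite phiE.
apply: is_derive_eq; rewrite /= /GRing.scale/=; field.
by rewrite gt_eqF// sqrtr_gt0 mulr_gt0// pi_gt0.
Qed.

Lemma continuous_phi : continuous (@phi R).
Proof.
move=> x; apply: differentiable_continuous; apply/derivable1_diffP.
by have [] := is_derive_phi x.
Qed.

Lemma integrable_phi (A : set R) : measurable A ->
  lebesgue_measure.-integrable A (EFin \o @phi R).
Proof. move=> mA; apply: (integrableS measurableT) => //; exact: integrable_normal_pdf. Qed.

Lemma Phibar_compl u :
  Phibar u = 1 - \int[lebesgue_measure]_(t in `]-oo, u]) phi t.
Proof.
rewrite PhibarE -Rintegral_itv_obnd_cbnd; last exact: integrable_phi.
apply/eqP; rewrite eq_sym subr_eq addrC eq_sym; apply/eqP.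
rewrite -Rintegral_setU//.
- by rewrite -setCitvl setUv; have := @integral_normal_pdf R 0 1; rewrite /Rintegral => ->.
- by apply: integrable_phi; apply: measurableU.
- by rewrite -setCitvl; apply/disj_setPCl.
Qed.

Lemma is_derive_Phibar u : is_derive u 1 (@Phibar R) (- phi u).
Proof.
have [dF F'] := @continuous_FTC1 R (@phi R) -oo%O u (u + 1) ltac:(by rewrite ltrDl)
  (integrable_phi _ (measurable_itv _)) (ltNyr _) (@continuous_phi u).
have -> : @Phibar R = (fun=> 1) - (fun x => \int[lebesgue_measure]_(t in `]-oo, x]) phi t).
  by apply/funext => x; rewrite Phibar_compl.
rewrite -[- phi u]add0r.
rewrite derive1E in F'.
by apply: is_deriveB; exact: DeriveDef.
Qed.

Lemma Phibar0 : Phibar 0 = 2^-1 :> R.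
Proof.
have := @ge0_symfun_integralT R (@phi R) (fun x => ltW (phi_gt0 x)) continuous_phi
  (fun x => esym (phiN x)).
rewrite -set_itvcy [X in X = _]integral_normal_pdf PhibarE /Rintegral => /esym/eqP.
set I := integral _ _ _.
have : I \is a fin_num by apply: integrable_fin_num => //; exact: integrable_phi.
move=> /fineK <-; rewrite -EFinM eqe => /eqP /=; move: (fine I) => i h.
by lra.
Qed.

(** By the mean value theorem Phibar(u) - Phibar(u+1) is a value of the positive
density. *)
Lemma Phibar_gt0 u : 0 < Phibar u.
Proof.
have dF x : x \in `]u, (u + 1)[ -> is_derive x 1 (@Phibar R) (- phi x).
  by move=> _; exact: is_derive_Phibar.
have cF : {within `[u, u + 1], continuous (@Phibar R)}.
  by apply: derivable_within_continuous => x _; have [] := is_derive_Phibar x.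
have [|c _] := MVT _ dF cF; first by rewrite ltrDl.
have : 0 <= Phibar (u + 1).
  by rewrite PhibarE Rintegral_ge0// => x _; exact/ltW/phi_gt0.
have := phi_gt0 c; lra.
Qed.

Lemma le_Phibar u x : u <= x -> Phibar x <= Phibar u.
Proof.
move=> ux; rewrite -lerN2.
have := @le_of_derive R (fun x => - Phibar x) (@phi R) u x ux; apply => y _.
- have := is_derive_Phibar y => ?; apply: is_derive_eq; by rewrite opprK.
- exact/ltW/phi_gt0.
Qed.
End gauss.

(** * Rational bounds for pi *)

Section pi.
Context {R : realType}.

(** Both differences vanish at 0, and their derivatives are the remainders
t^8/(1+t^2) and t^10/(1+t^2) of the geometric series of 1/(1+t^2). *)
Lemma atan_bounds (t : R) : 0 <= t ->
  t - t ^+ 3 / 3 + t ^+ 5 / 5 - t ^+ 7 / 7 <= atan t <=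
  t - t ^+ 3 / 3 + t ^+ 5 / 5 - t ^+ 7 / 7 + t ^+ 9 / 9.
Proof.
move=> t0; apply/andP; split; rewrite -subr_ge0.
- pose f x : R := atan x - (x - x ^+ 3 / 3 + x ^+ 5 / 5 - x ^+ 7 / 7).
  rewrite [leLHS](_ : 0 = f 0); last by rewrite /f atan0; field.
  apply: (@le_of_derive _ f (fun x => x ^+ 8 / (1 + x ^+ 2))) => // x xt.
    rewrite /f; apply: is_derive_eq; rewrite /= /GRing.scale/=; field.
    by rewrite gt_eqF// ltr_wpDr// sqr_ge0.
  by rewrite divr_ge0 ?addr_ge0 ?sqr_ge0 ?exprn_ge0//; case/andP: xt => /ltW.
- pose f x : R := (x - x ^+ 3 / 3 + x ^+ 5 / 5 - x ^+ 7 / 7 + x ^+ 9 / 9) - atan x.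
  rewrite [leLHS](_ : 0 = f 0); last by rewrite /f atan0; field.
  apply: (@le_of_derive _ f (fun x => x ^+ 10 / (1 + x ^+ 2))) => // x xt.
    rewrite /f; apply: is_derive_eq; rewrite /= /GRing.scale/=; field.
    by rewrite gt_eqF// ltr_wpDr// sqr_ge0.
  by rewrite divr_ge0 ?addr_ge0 ?sqr_ge0 ?exprn_ge0//; case/andP: xt => /ltW.
Qed.

(** Euler's formula: tan maps the right-hand side to
(1/2 + 1/3) / (1 - 1/6) = 1, and the crude bounds on the two arctangents place
their sum in ]-pi/2, pi/2[, where atan inverts tan. *)
Lemma pi_quarter_atan : pi / 4 = atan (2^-1) + atan (3^-1) :> R.
Proof.
rewrite -atan1 -[RHS]tanK; last first.
  have b2 := @atan_bounds 2^-1 ltac:(lra); have b3 := @atan_bounds 3^-1 ltac:(lra).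
  have := @pihalf_ge1 R; rewrite in_itv/=; lra.
rewrite tanD ?atanK.
- by congr atan; field.
- by rewrite gt_eqF// cos_gt0_pihalf// atan_gtNpi2 atan_ltpi2.
- by rewrite gt_eqF// cos_gt0_pihalf// atan_gtNpi2 atan_ltpi2.
Qed.

Lemma pi_bounds : 223 / 71 <= (pi : R) <= 421 / 134.
Proof.
have b2 := @atan_bounds 2^-1 ltac:(lra); have b3 := @atan_bounds 3^-1 ltac:(lra).
have := pi_quarter_atan; lra.
Qed.
End pi.

(** * Alternating Taylor bounds for the Gaussian tail *)

Section taylor.
Context {R : realType}.
Implicit Types u x y : R.

Definition exp_taylor n y : R := \sum_(k < n) (- y) ^+ k / k`!%:R.

Lemma exp_taylorS n y : exp_taylor n.+1 y = exp_taylor n y + (- y) ^+ n / n`!%:R.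
Proof. by rewrite /exp_taylor big_ord_recr. Qed.

Lemma is_derive_exp_taylor n y :
  is_derive y 1 (exp_taylor n.+1) (- exp_taylor n y).
Proof.
elim: n => [|n IH].
  have -> : exp_taylor 1 = cst 1.
    by apply/funext => z; rewrite /exp_taylor big_ord1 expr0 fact0 divr1.
  by rewrite /exp_taylor big_ord0 oppr0; exact: is_derive_cst.
have -> : exp_taylor n.+2 =
    exp_taylor n.+1 + (n.+1`!%:R)^-1 \*: (-%R ^+ n.+1).
  by apply/funext => z; rewrite exp_taylorS mulrC -[in RHS]/(_ + _ *: (-%R ^+ n.+1) z) exprfctE.
rewrite exp_taylorS opprD; apply: is_deriveD.
have h := is_deriveZ (n.+1`!%:R)^-1 (is_deriveX n.+1 (is_deriveNid y (1 : R))).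
apply: is_derive_eq; rewrite /= /GRing.scale/= factS natrM; field.
by rewrite (addrC 1) natr1 !pnatr_eq0 -lt0n fact_gt0.
Qed.

(** Induction on the order: each signed remainder vanishes at 0 and has the
previous one as its derivative. *)
Lemma exp_taylor_sign n y : 0 <= y -> 0 <= (-1) ^+ n * (expR (- y) - exp_taylor n y).
Proof.
elim: n y => [|n IH] y y0.
  by rewrite expr0 mul1r /exp_taylor big_ord0 subr0 expR_ge0.
pose f z := (-1) ^+ n.+1 * (expR (- z) - exp_taylor n.+1 z).
suff : f 0 <= f y.
  rewrite {1}/f /exp_taylor oppr0 expR0 big_ord_recl big1 => [|i _].
    by rewrite fact0 expr0 divr1 addr0 subrr mulr0.
  by rewrite expr0n mul0r.
apply: (@le_of_derive _ _ (fun z => (-1) ^+ n * (expR (- z) - exp_taylor n z)) _ _ y0).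
  move=> z _; rewrite /f; have := is_derive_exp_taylor n z => ?.
  apply: is_derive_eq; rewrite /= /GRing.scale/= exprS; ring.
by move=> z /andP[z0 _]; exact/IH/ltW.
Qed.

(** Termwise integral over [0, u] of the Taylor polynomial of exp(-t^2/2). *)
Definition gauss_taylor n u : R :=
  \sum_(k < n) (-1) ^+ k / (2 ^+ k * k`!%:R * (2 * k + 1)%:R) * u ^+ (2 * k + 1).

Lemma gauss_taylorS n u : gauss_taylor n.+1 u = gauss_taylor n u +
  (-1) ^+ n / (2 ^+ n * n`!%:R * (2 * n + 1)%:R) * u ^+ (2 * n + 1).
Proof. by rewrite /gauss_taylor big_ord_recr. Qed.

Lemma is_derive_gauss_taylor n u :
  is_derive u 1 (gauss_taylor n) (exp_taylor n (u ^+ 2 / 2)).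
Proof.
elim: n => [|n IH].
  have -> : gauss_taylor 0 = cst 0.
    by apply/funext => z; rewrite /gauss_taylor big_ord0.
  by rewrite /exp_taylor big_ord0; exact: is_derive_cst.
have -> : gauss_taylor n.+1 = gauss_taylor n +
    ((-1) ^+ n / (2 ^+ n * n`!%:R * (2 * n + 1)%:R)) \*: (id ^+ (2 * n + 1)).
  by apply/funext => z; rewrite gauss_taylorS -[in RHS]/(_ + _ *: (id ^+ (2 * n + 1)) z) exprfctE.
rewrite exp_taylorS; apply: is_deriveD.
set c := _ / _.
have h := is_deriveZ c (is_deriveX (2 * n + 1) (is_derive_id u (1 : R))).
rewrite {}/c in h *.
apply: (is_derive_eq h); rewrite /= /GRing.scale/= addn1 /= exprM.
have n1 : (2 * n).+1%:R != 0 :> R by rewrite pnatr_eq0.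
move: ((2 * n).+1%:R) n1 => N n1.
have -> : (- (u ^+ 2 / 2)) ^+ n = (-1) ^+ n * (u ^+ 2) ^+ n / 2 ^+ n :> R.
  by rewrite [LHS]exprNn expr_div_n mulrA.
field.
by rewrite n1 pnatr_eq0 -lt0n fact_gt0 expf_neq0.
Qed.

Lemma phi_expR u : phi u = phi 0 * expR (- (u ^+ 2 / 2)).
Proof. by rewrite !phiE expr0n mul0r oppr0 expR0 mulrAC div1r mulrC. Qed.

(** This is [exp_taylor_sign] at u^2/2, integrated from 0, since
Phibar(u) = 1/2 - phi(0) * int_0^u exp(-t^2/2) dt. *)
Lemma Phibar_taylor_sign n u : 0 <= u ->
  0 <= (-1) ^+ n * (2^-1 - phi 0 * gauss_taylor n u - Phibar u).
Proof.
move=> u0; pose f v : R := (-1) ^+ n * (2^-1 - phi 0 * gauss_taylor n v - Phibar v).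
suff : f 0 <= f u.
  rewrite {1}/f Phibar0 /gauss_taylor big1 ?mulr0 ?subr0 ?subrr ?mulr0// => i _.
  by rewrite addn1 expr0n mulr0.
apply: (@le_of_derive _ _ (fun v => phi 0 *
  ((-1) ^+ n * (expR (- (v ^+ 2 / 2)) - exp_taylor n (v ^+ 2 / 2)))) _ _ u0).
  move=> v _; rewrite /f.
  have := is_derive_gauss_taylor n v => ?; have := is_derive_Phibar v => ?.
  apply: is_derive_eq; rewrite /= /GRing.scale/= (phi_expR v); ring.
move=> v _; rewrite mulr_ge0 ?(ltW (phi_gt0 _))//; apply: exp_taylor_sign.
by rewrite mulr_ge0 ?sqr_ge0.
Qed.
End taylor.

(** * Numerical values *)

Section numerics.
Context {R : realType}.
Implicit Types u x y : R.

Lemma phi0_sqr : (phi 0 : R) ^+ 2 * (2 * pi) = 1.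
Proof.
rewrite phiE expr0n mul0r oppr0 expR0 div1r exprVn sqr_sqrtr.
  by rewrite mulVf// mulf_neq0// gt_eqF// pi_gt0.
by rewrite mulr_ge0// pi_ge0.
Qed.

Lemma phi0_bounds : 361 / 905 <= (phi 0 : R) <= 399 / 1000.
Proof.
have z0 := @phi_gt0 R 0; have := phi0_sqr.
have := @pi_bounds R; move: (phi 0) (pi) z0 => z p z0 pb e.
by apply/andP; split; nra.
Qed.

Lemma sqrt2_bounds : 1393 / 985 <= (Num.sqrt 2 : R) <= 577 / 408.
Proof.
have := sqrtr_ge0 (2 : R); have : (Num.sqrt 2 : R) ^+ 2 = 2 by rewrite sqr_sqrtr.
by move=> h s0; apply/andP; split; nra.
Qed.

Lemma sqrt3_bounds : 989 / 571 <= (Num.sqrt 3 : R) <= 1351 / 780.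
Proof.
have := sqrtr_ge0 (3 : R); have : (Num.sqrt 3 : R) ^+ 2 = 3 by rewrite sqr_sqrtr.
by move=> h s0; apply/andP; split; nra.
Qed.

Lemma expRN_bounds y : 0 <= y ->
  1 - y + y ^+ 2 / 2 - y ^+ 3 / 6 + y ^+ 4 / 24 - y ^+ 5 / 120 <= expR (- y) <=
  1 - y + y ^+ 2 / 2 - y ^+ 3 / 6 + y ^+ 4 / 24 - y ^+ 5 / 120 + y ^+ 6 / 720.
Proof.
move=> y0; have := exp_taylor_sign 6 _ y0; have := exp_taylor_sign 7 _ y0.
have -> : exp_taylor 7 y = exp_taylor 6 y + y ^+ 6 / 720.
  by rewrite exp_taylorS (_ : 6`!%N = 720)//; field.
have -> : exp_taylor 6 y =
    1 - y + y ^+ 2 / 2 - y ^+ 3 / 6 + y ^+ 4 / 24 - y ^+ 5 / 120.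
  rewrite !exp_taylorS /exp_taylor big_ord0 fact0 (_ : 1`! = 1)%N// (_ : 2`! = 2)%N//.
  by rewrite (_ : 3`! = 6)%N// (_ : 4`! = 24)%N// (_ : 5`! = 120)%N//; field.
rewrite -(signr_odd _ 6) -(signr_odd _ 7) /= expr0 expr1; lra.
Qed.

(** The seven-term series of (int_0^u exp(-t^2/2) dt) / u as a polynomial in
q = u^2, so that at u = sqrt 2 and u = sqrt 3 it has rational values. *)
Definition erf_taylor (q : R) : R :=
  1 - q / 6 + q ^+ 2 / 40 - q ^+ 3 / 336 + q ^+ 4 / 3456 -
      q ^+ 5 / (384 * 110) + q ^+ 6 / (4608 * 130).

Lemma Phibar_bounds (u q : R) : 0 <= u -> u ^+ 2 = q ->
  2^-1 - phi 0 * u * erf_taylor q <= Phibar u <=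
  2^-1 - phi 0 * u * (erf_taylor q - q ^+ 7 / (3840 * 2520)).
Proof.
move=> u0 qE; have := Phibar_taylor_sign 7 _ u0; have := Phibar_taylor_sign 8 _ u0.
have -> : gauss_taylor 8 u = gauss_taylor 7 u - u * (q ^+ 7 / (3840 * 2520)).
  by rewrite gauss_taylorS (_ : 7`! = 7 * 720)%N// natrM -qE /=; field.
have -> : gauss_taylor 7 u = u * erf_taylor q.
  rewrite !gauss_taylorS /gauss_taylor big_ord0 fact0 (_ : 1`! = 1)%N// (_ : 2`! = 2)%N//.
  by rewrite (_ : 3`! = 6)%N// (_ : 4`! = 24)%N// (_ : 5`! = 120)%N// (_ : 6`! = 720)%N//
    /erf_taylor -qE /=; field.
rewrite -(signr_odd _ 7) -(signr_odd _ 8) /= expr0 expr1.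
move: (erf_taylor q) (phi 0 : R) => S z; rewrite -!mulrA mulrBr; lra.
Qed.

(** The series multiplies phi(0) u, whose square is u^2 / (2 pi); a rational
bound a or b on phi(0) u is thus certified by comparing squares, where 421/67
and 446/71 are twice the upper and lower bounds for pi.  This avoids separate
approximations of phi(0) and u, whose errors would add up. *)
Lemma Phibar_window (u q a b l h : R) : 0 <= h -> 0 <= u -> u ^+ 2 = q ->
  0 <= a -> a ^+ 2 * (421 / 67) <= q ->
  0 <= b -> q <= b ^+ 2 * (446 / 71) ->
  0 <= l -> l <= erf_taylor q - q ^+ 7 / (3840 * 2520) ->
  erf_taylor q <= h ->
  2^-1 - b * h <= Phibar u <= 2^-1 - a * l.
Proof.
move=> h0 u0 qE a0 aq b0 bq l0; have := Phibar_bounds u q u0 qE.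
move: (erf_taylor q) (_ / _) => S1 e; have := @pi_bounds R; have := phi0_sqr.
have q0 : 0 <= q by rewrite -qE sqr_ge0.
have := @phi_gt0 R 0; move: (phi 0 : R) (pi : R) (Phibar u) => z p P z0 zp pb Pb lS Sh.
have zq : (z * u) ^+ 2 * (2 * p) = q by rewrite exprMn qE mulrAC zp mul1r.
have zu0 : 0 <= z * u by rewrite mulr_ge0// ltW.
move: (z * u) zq zu0 Pb => w zq w0 Pb.
have aw : a <= w by rewrite -(@ler_pXn2r _ 2)// ?nnegrE//; nra.
have wb : w <= b by rewrite -(@ler_pXn2r _ 2)// ?nnegrE//; nra.
have lw : a * l <= w * (S1 - e) by rewrite ler_pM.
have wh : w * S1 <= b * h.
  have [S0|S0] := leP 0 S1; first by rewrite ler_pM.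
  by rewrite (le_trans (mulr_ge0_le0 w0 (ltW S0)))// mulr_ge0.
by lra.
Qed.

Lemma expRN_half_bounds : 94 / 155 <= expR (- 2^-1 : R) <= 37 / 61.
Proof. have := @expRN_bounds 2^-1 ltac:(lra); lra. Qed.

Lemma phi_27_25 : phi (27 / 25 : R) = phi 0 * expR (- (729 / 1250)).
Proof. by rewrite phi_expR; congr (_ * expR (- _)); field. Qed.

Lemma phi_sqrt2 : phi (Num.sqrt 2 : R) = phi 0 * expR (- 2^-1) ^+ 2.
Proof. by rewrite phi_expR sqr_sqrtr// -expRM_natl; congr (_ * expR _); field. Qed.

Lemma phi_sqrt3 : phi (Num.sqrt 3 : R) = phi 0 * expR (- 2^-1) ^+ 3.
Proof. by rewrite phi_expR sqr_sqrtr// -expRM_natl; congr (_ * expR _); field. Qed.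

Lemma Phibar_1 : 79 / 500 <= Phibar (1 : R).
Proof.
have := Phibar_window 1 1 0 (399 / 1000) 0 (83 / 97) ltac:(lra).
rewrite /erf_taylor !expr1n; lra.
Qed.

Lemma Phibar_27_25 : 137 / 980 <= Phibar (27 / 25 : R).
Proof.
have W := Phibar_window (27 / 25) (729 / 625) 0 (431 / 1000) 0 (66 / 79)
  ltac:(lra) ltac:(lra) ltac:(lra) ltac:(lra) ltac:(lra) ltac:(lra) ltac:(lra) ltac:(lra).
have h : 0 <= erf_taylor (729 / 625) - (729 / 625) ^+ 7 / (3840 * 2520).
  by clear; rewrite /erf_taylor; lra.
have h' : erf_taylor (729 / 625) <= 66 / 79 by clear; rewrite /erf_taylor; lra.
by move: (W h h'); clear; lra.
Qed.

Lemma Phibar_sqrt2 : 53 / 675 <= Phibar (Num.sqrt 2 : R) <= 17 / 216.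
Proof.
have : 2^-1 - 79 / 140 * (239 / 320) <= Phibar (Num.sqrt 2 : R) <=
    2^-1 - 299 / 530 * (351 / 470).
  apply: (@Phibar_window _ 2).
  - lra.
  - exact: sqrtr_ge0.
  - by rewrite sqr_sqrtr.
  - lra.
  - lra.
  - lra.
  - lra.
  - lra.
  - by rewrite /erf_taylor; lra.
  - by rewrite /erf_taylor; lra.
lra.
Qed.

Lemma Phibar_sqrt3 : 4 / 97 <= Phibar (Num.sqrt 3 : R) <= 41 / 980.
Proof.
have : 2^-1 - 47 / 68 * (73 / 110) <= Phibar (Num.sqrt 3 : R) <=
    2^-1 - 38 / 55 * (65 / 98).
  apply: (@Phibar_window _ 3); rewrite ?sqrtr_ge0 ?sqr_sqrtr /erf_taylor//; lra.
lra.
Qed.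
End numerics.

(** * The damped tail *)

Section stationary.
Context {R : realType}.

(** Freezing a function at a stationary point keeps it differentiable: at c the
difference quotients of the frozen function are those of f or 0, and both tend
to 0. *)
Lemma is_derive_min (f df : R -> R) (c u : R) :
  (forall x : R, is_derive x (1 : R) f (df x)) -> df c = 0 ->
  is_derive u (1 : R) (fun x => f (Num.min x c)) (df (Num.min u c)).
Proof.
move=> fdf dfc; have [uc|cu|->] := ltgtP u c.
- apply: (near_eq_is_derive _ (fdf u)).
  by near=> x; rewrite min_l//; apply: ltW; near: x; exact: lt_nbhsl.
- rewrite dfc; apply: (near_eq_is_derive _ (is_derive_cst (f c) u 1)).
  by near=> x; rewrite min_r//; apply: ltW; near: x; exact: lt_nbhsr.
- have [cvf Df] := fdf c; rewrite dfc in Df *.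
  have cf : h^-1 *: ((f \o shift c) (h *: (1 : R)) - f c) @[h --> 0^'] --> 'D_(1 : R) f c.
    exact: cvf.
  rewrite Df in cf.
  have cF : h^-1 *: (((fun x => f (Num.min x c)) \o shift c) (h *: (1 : R)) -
      f (Num.min c c)) @[h --> 0^'] --> (0 : R).
    apply/cvgr0Pnorm_lt => e e0; move/cvgr0Pnorm_lt : cf => /(_ e e0).
    apply: filterS => h; apply: le_lt_trans; rewrite !normrZ ler_wpM2l//= minxx.
    by have [//|_] := leP (h *: 1 + c) c; rewrite subrr normr0.
  apply: DeriveDef; first by apply/cvg_ex; exists 0.
  exact/cvg_lim.
Unshelve. all: by end_near. Qed.
End stationary.

Section profile.
Context {R : realType}.
Implicit Types u x : R.

(** The relative amount by which the slope of the tail is reduced below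
sqrt 3, where the two-point inequality fails for Phibar. *)
Definition kappa u := (3 - Num.min u (Num.sqrt 3) ^+ 2) ^+ 3 / 40.

(** The integral of (3 - t^2)^3 phi(t) over [u, +oo[, in closed form. *)
Definition cube_tail u :=
  12 * Phibar u + phi u * (- 15 * u + 4 * u ^+ 3 - u ^+ 5).

Lemma is_derive_cube_tail u :
  is_derive u 1 cube_tail (- (3 - u ^+ 2) ^+ 3 * phi u).
Proof.
have := is_derive_Phibar u => ?; have := is_derive_phi u => ?.
apply: is_derive_eq; rewrite /= /GRing.scale/=; ring.
Qed.

(** The correction is the integral of kappa phi over [u, +oo[: the part of
[cube_tail] between u and sqrt 3, divided by 40. *)
Definition profile u :=
  Phibar u - (cube_tail (Num.min u (Num.sqrt 3)) - cube_tail (Num.sqrt 3)) / 40.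

Lemma is_derive_profile u : is_derive u 1 profile (- (1 - kappa u) * phi u).
Proof.
(* (3 - u^2)^3 vanishes at sqrt 3, so cube_tail is stationary there. *)
have hm := @is_derive_min R cube_tail _ (Num.sqrt 3) u is_derive_cube_tail.
have {hm} := hm _; rewrite sqr_sqrtr// subrr expr0n mulr0n oppr0 mul0r => /(_ erefl) ?.
have := is_derive_Phibar u => ?.
apply: is_derive_eq; rewrite /= /GRing.scale/= /kappa.
have [us|us] := leP u (Num.sqrt 3); first by field.
by rewrite sqr_sqrtr//; field.
Qed.

Lemma kappa_ge0 u : 0 <= u -> 0 <= kappa u.
Proof.
move=> u0; rewrite divr_ge0// exprn_ge0// subr_ge0.
rewrite -[leRHS](@sqr_sqrtr _ 3)// ler_pXn2r// ?nnegrE ?sqrtr_ge0//.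
  by rewrite ge_min lexx orbT.
by rewrite le_min u0 sqrtr_ge0.
Qed.

Lemma le_kappa u x : 0 <= u -> u <= x -> kappa x <= kappa u.
Proof.
move=> u0 ux; have x0 := le_trans u0 ux.
have min_ge0 (y : R) : 0 <= y -> 0 <= Num.min y (Num.sqrt 3).
  by move=> y0; rewrite le_min y0 sqrtr_ge0.
have min_le (y : R) : Num.min y (Num.sqrt 3) <= Num.sqrt 3 by rewrite ge_min lexx orbT.
have mono : Num.min u (Num.sqrt 3) <= Num.min x (Num.sqrt 3).
  by rewrite le_min min_le andbT ge_min ux.
have := min_ge0 _ u0; have := min_ge0 _ x0; have := min_le u; have := min_le x.
have := @sqr_sqrtr R 3 ltac:(lra).
rewrite /kappa; move: mono.
move: (Num.sqrt 3 : R) (Num.min u _) (Num.min x _) => c a b ab c3 bc ac b0 a0.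
by rewrite ler_pM2r ?invr_gt0// ler_pXn2r// ?nnegrE; nra.
Qed.

Lemma kappa_small u : u <= Num.sqrt 3 -> kappa u = (3 - u ^+ 2) ^+ 3 / 40.
Proof. by move=> us; rewrite /kappa min_l. Qed.

Lemma kappa_large u : Num.sqrt 3 <= u -> kappa u = 0.
Proof. by move=> us; rewrite /kappa min_r// sqr_sqrtr// subrr expr0n mul0r. Qed.

Lemma kappa_le1 u : 27 / 25 <= u -> kappa u <= 1.
Proof.
move=> u0; apply: (le_trans (@le_kappa (27/25) u ltac:(lra) u0)).
rewrite kappa_small; first lra.
have := @sqrt3_bounds R; lra.
Qed.

Lemma profile_large u : Num.sqrt 3 <= u -> profile u = Phibar u.
Proof. by move=> us; rewrite /profile min_r// subrr mul0r subr0. Qed.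

Lemma profile_small u : u <= Num.sqrt 3 ->
  profile u = 7 / 10 * Phibar u + 3 / 10 * Phibar (Num.sqrt 3) +
  (phi u * (15 * u - 4 * u ^+ 3 + u ^+ 5) - 12 * Num.sqrt 3 * phi (Num.sqrt 3)) / 40.
Proof.
move=> us; rewrite /profile min_l// /cube_tail.
have -> : (Num.sqrt 3 : R) ^+ 5 = 9 * Num.sqrt 3.
  by rewrite exprSr (exprM _ 2 2) sqr_sqrtr//; ring.
have -> : (Num.sqrt 3 : R) ^+ 3 = 3 * Num.sqrt 3 by rewrite exprSr sqr_sqrtr.
by field.
Qed.

Lemma le_profile_Phibar u : 0 <= u -> profile u <= Phibar u.
Proof.
move=> u0; rewrite /profile lerBlDr lerDl divr_ge0// subr_ge0 -lerN2.
set m := Num.min _ _.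
have ms : m <= Num.sqrt 3 by rewrite ge_min lexx orbT.
have := @le_of_derive R (fun x => - cube_tail x)
  (fun x => (3 - x ^+ 2) ^+ 3 * phi x) m (Num.sqrt 3) ms.
apply => x /andP[mx xs].
  have := is_derive_cube_tail x => ?; by apply: is_derive_eq; rewrite mulNr opprK.
have m0 : 0 <= m by rewrite le_min u0 sqrtr_ge0.
have := @sqr_sqrtr R 3 ltac:(lra) => s3; rewrite mulr_ge0 ?(ltW (phi_gt0 _))// exprn_ge0//.
nra.
Qed.

Lemma le_profile u x : 27 / 25 <= u -> u <= x -> profile x <= profile u.
Proof.
move=> u0 ux; rewrite -lerN2.
have := @le_of_derive R (fun x => - profile x) (fun x => (1 - kappa x) * phi x) u x ux.
apply => y /andP[uy yx].
  have := is_derive_profile y => ?; apply: is_derive_eq; by rewrite mulNr opprK.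
by rewrite mulr_ge0 ?(ltW (phi_gt0 _))// subr_ge0 kappa_le1// (le_trans u0)// ltW.
Qed.

End profile.

(** * Chebyshev's bound against the tail *)

Section shape.
Context {R : realType}.
Implicit Types u x : R.

(** The logarithmic derivative of x^3 phi(x) is 3/x - x. *)
Lemma le_cube_phi u x : 0 <= u -> u <= x -> x <= Num.sqrt 3 ->
  u ^+ 3 * phi u <= x ^+ 3 * phi x.
Proof.
move=> u0 ux x3.
have := @le_of_derive R (fun y => y ^+ 3 * phi y)
  (fun y => y ^+ 2 * (3 - y ^+ 2) * phi y) u x ux.
apply => y /andP[uy yx].
  have := is_derive_phi y => ?; apply: is_derive_eq; rewrite /= /GRing.scale/=; ring.
rewrite mulr_ge0 ?(ltW (phi_gt0 _))// mulr_ge0 ?sqr_ge0// subr_ge0.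
have := @sqr_sqrtr R 3 ltac:(lra); nra.
Qed.

(** The difference K f(u) - 1/(2u^2) has derivative
(1 - K k(u) u^3 phi(u)) / u^3.  On [0, sqrt 3] both k and u^3 phi(u) increase,
so the difference first increases and then decreases, and its minimum is at an
endpoint.  With k = 1 this serves for Phibar, with k = 1 - kappa for
[profile]. *)
Lemma inv_sqr_le_of_endpoints (f k : R -> R) (K a b u : R) :
  0 < a -> b <= Num.sqrt 3 -> 0 <= K ->
  (forall x, a <= x <= b -> is_derive x (1 : R) f (- k x * phi x)) ->
  (forall x y, a <= x -> x <= y -> y <= b -> 0 <= k x <= k y) ->
  (2 * a ^+ 2)^-1 <= K * f a -> (2 * b ^+ 2)^-1 <= K * f b ->
  a <= u <= b -> (2 * u ^+ 2)^-1 <= K * f u.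
Proof.
move=> a0 b3 K0 fk kk Ja Jb /andP[au ub].
pose m x := K * (k x * (x ^+ 3 * phi x)).
have m_mono x y : a <= x -> x <= y -> y <= b -> m x <= m y.
  move=> ax xy yb; rewrite ler_wpM2l//; have /andP[k0 k1] := kk x y ax xy yb.
  rewrite ler_pM// ?le_cube_phi//; try lra.
  by rewrite mulr_ge0 ?(ltW (phi_gt0 _))// exprn_ge0//; lra.
have dJ x : a <= x <= b ->
    is_derive x (1 : R) (fun y => K * f y - (2 * y ^+ 2)^-1) ((1 - m x) / x ^+ 3).
  move=> axb; have x0 : x != 0 by rewrite gt_eqF//; lra.
  have := fk x axb => ?.
  have hV : 2 * x ^+ 2 != 0 by rewrite mulf_neq0 ?expf_neq0.
  have := is_deriveV hV => ?.
  apply: is_derive_eq; rewrite /= /GRing.scale/= /m; field.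
  by rewrite x0.
have [m1|m1] := leP (m u) 1.
- rewrite -subr_ge0; apply: (@le_trans _ _ (K * f a - (2 * a ^+ 2)^-1)).
    by rewrite subr_ge0.
  apply: (@le_of_derive _ (fun y => K * f y - (2 * y ^+ 2)^-1) _ a u au) => x /andP[ax xu].
    by apply: dJ; lra.
  rewrite divr_ge0 ?exprn_ge0 ?subr_ge0//; last lra.
  by rewrite (le_trans _ m1)// m_mono//; lra.
- rewrite -subr_ge0; apply: (@le_trans _ _ (K * f b - (2 * b ^+ 2)^-1)).
    by rewrite subr_ge0.
  rewrite -lerN2.
  apply: (@le_of_derive _ (fun y => - (K * f y - (2 * y ^+ 2)^-1))
    (fun x => - ((1 - m x) / x ^+ 3)) u b ub) => x /andP[ux xb].
    by have := dJ x ltac:(lra) => ?; apply: is_derive_eq.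
  rewrite -mulNr opprB divr_ge0 ?exprn_ge0 ?subr_ge0//; last lra.
  by rewrite (le_trans (ltW m1))// m_mono//; lra.
Qed.

Lemma c1_gt0 : 0 < c1 R.
Proof. by rewrite divr_gt0// mulr_gt0// Phibar_gt0. Qed.

Lemma c1_Phibar : c1 R * Phibar (Num.sqrt 2) = 1 / 4.
Proof. by rewrite /c1; field; rewrite gt_eqF// Phibar_gt0. Qed.

Lemma c1_bounds : 108 / 34 <= c1 R <= 675 / 212.
Proof.
have := c1_Phibar; have := c1_gt0; have := @Phibar_sqrt2 R.
by move: (c1 R) (Phibar _ : R) => c p; nra.
Qed.

Lemma phi_sqrt3_bounds : 889 / 1000 * 1/10 <= phi (Num.sqrt 3 : R) <= 891 / 1000 * 1/10.
Proof.
rewrite phi_sqrt3; have := @phi0_bounds R; have := @expRN_half_bounds R.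
move: (phi 0 : R) (expR _ : R) => z e eb zb.
have e3 : 2230 / 1000 * 1/10 <= e ^+ 3 <= 2232 / 1000 * 1 / 10 by nra.
nra.
Qed.

Lemma inv_mills_bounds : 212 / 100 <= inv_mills (Num.sqrt 3 : R) <= 217 / 100.
Proof.
rewrite /inv_mills; have p0 := @Phibar_gt0 R (Num.sqrt 3).
have := phi_sqrt3_bounds; have := @Phibar_sqrt3 R.
move: (phi _ : R) (Phibar _ : R) p0 => z p p0 pb zb.
by rewrite ler_pdivlMr// ler_pdivrMr//; lra.
Qed.

Lemma c2_bounds : 3215 / 1000 < c2 R < 3225 / 1000.
Proof.
rewrite /c2; have := inv_mills_bounds; have := c1_bounds.
move: (c1 R) (inv_mills _) => c r cb rb; nra.
Qed.

(** The value is 1/4 + (1 + r(sqrt 3)) / 1000: the room above the Chebyshev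
value 1/4 at sqrt 2. *)
Lemma c2_Phibar : 253 / 1000 <= c2 R * Phibar (Num.sqrt 2).
Proof.
rewrite /c2 mulrAC c1_Phibar; have := inv_mills_bounds; lra.
Qed.
End shape.

Section endpoints.
Context {R : realType}.
Implicit Types u x : R.

Lemma sqrt2_le_sqrt3 : (Num.sqrt 2 : R) <= Num.sqrt 3.
Proof. by rewrite ler_sqrt// ler_nat. Qed.

Lemma chebyshev_le_Phibar u : 1 <= u <= Num.sqrt 2 -> (2 * u ^+ 2)^-1 <= c2 R * Phibar u.
Proof.
apply: (@inv_sqr_le_of_endpoints R (@Phibar R) (cst 1) (c2 R) 1 (Num.sqrt 2) u) => //.
- exact: sqrt2_le_sqrt3.
- by have := @c2_bounds R; lra.
- by move=> x _; have := is_derive_Phibar x; rewrite mulN1r.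
- by move=> x y _ _ _; rewrite ler01 lexx.
- by rewrite expr1n; have := @Phibar_1 R; have := @c2_bounds R; nra.
- by rewrite sqr_sqrtr//; have := @c2_Phibar R; lra.
Qed.

Lemma sqrt3_phi_sqrt3 : Num.sqrt 3 * phi (Num.sqrt 3 : R) <= 1544 / 10000.
Proof.
have := @sqrt3_bounds R; have := @phi_sqrt3_bounds R.
by move: (Num.sqrt 3 : R) (phi _) => s p *; nra.
Qed.

(** The two sides are about 0.4287 and 0.4332. *)
Lemma chebyshev_le_profile_27_25 : (2 * (27 / 25) ^+ 2)^-1 <= c2 R * profile (27 / 25).
Proof.
rewrite profile_small; last by have := @sqrt3_bounds R; lra.
have p1 : 2225 / 10000 <= phi (27 / 25 : R).
  rewrite phi_27_25; have := @phi0_bounds R; have := @expRN_bounds R (729 / 1250) ltac:(lra).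
  move: (phi 0 : R) (expR _) => z e eb zb.
  have : 558 / 1000 <= e by lra.
  by nra.
have P1 := @Phibar_27_25 R.
have P3 := @Phibar_sqrt3 R; have K := @c2_bounds R; have sp := sqrt3_phi_sqrt3.
rewrite -(mulrA 12).
move: (c2 R) (Phibar (27 / 25 : R)) (phi (27 / 25 : R)) (Phibar (Num.sqrt 3 : R))
  (Num.sqrt 3 * _) K P1 p1 P3 sp.
move=> K P p P3 sp Kb Pb pb P3b spb.
have : 1341 / 10000 <= 7 / 10 * P + 3 / 10 * P3 +
  (p * (15 * (27 / 25) - 4 * (27 / 25) ^+ 3 + (27 / 25) ^+ 5) - 12 * sp) / 40 by lra.
by move: (_ + _ + _) => Q; nra.
Qed.

(** The loss c2 * (Phibar - profile) at sqrt 2 is about 0.0009, less than the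
excess 0.003 of c2 * Phibar(sqrt 2) over 1/4. *)
Lemma chebyshev_le_profile_sqrt2 : 1 / 4 <= c2 R * profile (Num.sqrt 2).
Proof.
rewrite profile_small ?sqrt2_le_sqrt3//.
have -> : (Num.sqrt 2 : R) ^+ 5 = 4 * Num.sqrt 2.
  by rewrite exprSr (exprM _ 2 2) sqr_sqrtr//; ring.
have -> : (Num.sqrt 2 : R) ^+ 3 = 2 * Num.sqrt 2 by rewrite exprSr sqr_sqrtr.
have -> : 15 * Num.sqrt 2 - 4 * (2 * Num.sqrt 2) + 4 * Num.sqrt 2 =
  11 * Num.sqrt 2 :> R by ring.
have sp2 : 207 / 1000 <= phi (Num.sqrt 2 : R) * Num.sqrt 2.
  rewrite phi_sqrt2.
  have := @phi0_bounds R; have := @expRN_half_bounds R; have := @sqrt2_bounds R.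
  move: (phi 0 : R) (expR _) (Num.sqrt 2 : R) => z e s sb eb zb.
  have e2 : 3677 / 10000 <= e ^+ 2 by nra.
  have e2s : 3677 / 10000 * (1393 / 985) <= e ^+ 2 * s by nra.
  by rewrite -mulrA; nra.
have P3 := @Phibar_sqrt3 R; have K := @c2_bounds R; have sp := sqrt3_phi_sqrt3.
have KP := @c2_Phibar R.
rewrite -(mulrA 12) (mulrCA (phi _) 11).
move: (c2 R) (Phibar (Num.sqrt 2)) (Phibar (Num.sqrt 3 : R)) (Num.sqrt 3 * _)
  (phi _ * _) K P3 sp KP sp2.
move=> K P P3 s3 s2 Kb P3b s3b KPb s2b.
have h : 229 / 10000 <= 3 / 10 * P3 + (11 * s2 - 12 * s3) / 40 by lra.
rewrite -addrA mulrDr; move: (_ + _ / 40) h => Q Qb.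
by nra.
Qed.

Lemma chebyshev_le_profile u : 27 / 25 <= u <= Num.sqrt 2 ->
  (2 * u ^+ 2)^-1 <= c2 R * profile u.
Proof.
have s2 := @sqrt2_bounds R.
apply: (@inv_sqr_le_of_endpoints R profile (fun x => 1 - kappa x) (c2 R)
  (27 / 25) (Num.sqrt 2) u) => //.
- exact: sqrt2_le_sqrt3.
- by have := @c2_bounds R; lra.
- by move=> x _; exact: is_derive_profile.
- move=> x y ax xy yb; rewrite subr_ge0 kappa_le1//= lerD2l lerN2 le_kappa//; lra.
- exact: chebyshev_le_profile_27_25.
- by rewrite sqr_sqrtr// (le_trans _ chebyshev_le_profile_sqrt2)//; lra.
Qed.
End endpoints.

(** * The tilt of the density and the damping *)

(** Truncated series of artanh. *)
Local Notation artanh5 s := (s + s ^+ 3 / 3 + s ^+ 5 / 5).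

Section poly.
Context {R : realType}.
Implicit Types x t s : R.

(** With A = (x - t) / sqrt (1 - t^2) this is (1 - t^2) (3 - A^2); the
corresponding quantity for B = (x + t) / sqrt (1 - t^2) is [gap x (- t)]. *)
Local Notation gap x t := (3 - x ^+ 2 - 4 * t ^+ 2 + 2 * x * t).

(** A polynomial upper bound, linear in y = x^2, for (1 - t^2)^2 times the
factor E in w - artanh5 s = (s t^2 / (1 - t^2)) * E, where s = x t, z = t^2 and
w = s / (1 - t^2).  See [tilt_excess_factor_le]. *)
Local Notation excess y z := ((3 - y) / 3 * (1 - 6 / 10 * z) - 256 / 1000 * z).

(** The tangent to the cube at D = 13/5 t, divided by t^2.  The inequality is
tightest near x = 1.53 and t = 1/sqrt 5, where D/t is about 2.75; a nearby slope
with small numerator and denominator suffices. *)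
Local Notation cube_tangent D t := (3 * (13 / 5) ^+ 2 * D - 2 * (13 / 5) ^+ 3 * t).

(** Taking logarithms, this says that artanh s = (ln(1+s) - ln(1-s)) / 2 is at
least its truncated series; the derivative of the remainder is
s^6 / (1 - s^2). *)
Lemma expR_artanh_le s : 0 <= s -> s < 1 ->
  (1 - s) * expR (2 * artanh5 s) <= 1 + s.
Proof.
move=> s0 s1.
have h : 0 <= ln (1 + s) - ln (1 - s) - 2 * artanh5 s.
  pose f s := ln (1 + s) - ln (1 - s) - 2 * artanh5 s.
  suff : f 0 <= f s by rewrite {1}/f addr0 subr0 ln1 !expr0n/= !mul0r !addr0 mulr0 !subr0.
  apply: (@le_of_derive _ _ (fun x => 2 * x ^+ 6 / ((1 + x) * (1 - x))) _ _ s0) => x xs.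
    have p1 : 0 < 1 + x by lra.
    have p2 : 0 < 1 - x by lra.
    have d1 : is_derive x (1 : R) (fun x => ln (1 + x)) (1 + x)^-1.
      have := is_derive1_ln p1 => ?; apply: is_derive_eq; rewrite /= /GRing.scale/=; ring.
    have d2 : is_derive x (1 : R) (fun x => ln (1 - x)) (- (1 - x)^-1).
      have := is_derive1_ln p2 => ?; apply: is_derive_eq; rewrite /= /GRing.scale/=; ring.
    rewrite /f; apply: is_derive_eq; rewrite /= /GRing.scale/=; field.
    by rewrite !gt_eqF.
  by rewrite divr_ge0 ?mulr_ge0 ?exprn_ge0//; lra.
rewrite -ler_ln ?posrE; [|by rewrite mulr_gt0 ?expR_gt0//; lra|lra].
rewrite lnM ?posrE ?expR_gt0//; last lra.
by rewrite expRK; lra.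
Qed.

(** Since x^2 >= 3 means t^2 <= s^2/3, it suffices that
s <= (1 - s^2/3) artanh5 s; the cubic terms cancel and what remains is
s^5 (4/45 - s^2/15), which is nonnegative for s <= 1. *)
Lemma tilt_le_artanh x t : 3 <= x ^+ 2 -> 0 <= t -> t < 1 -> 0 <= x -> x * t <= 1 ->
  x * t / (1 - t ^+ 2) <= artanh5 (x * t).
Proof.
move=> x3 t0 t1 x0 s1.
have t2 : 0 < 1 - t ^+ 2 by nra.
rewrite ler_pdivrMr//.
set s := x * t in s1 *.
have s0 : 0 <= s by rewrite mulr_ge0.
have st : t ^+ 2 <= s ^+ 2 / 3.
  rewrite /s exprMn; have := sqr_ge0 t; nra.
have h : s <= artanh5 s * (1 - s ^+ 2 / 3).
  rewrite -subr_ge0.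
  have -> : artanh5 s * (1 - s ^+ 2 / 3) - s = s ^+ 5 * (4 / 45 - s ^+ 2 / 15) by field.
  by rewrite mulr_ge0 ?exprn_ge0//; nra.
apply: (le_trans h); rewrite ler_wpM2l//; last lra.
by rewrite !addr_ge0 ?divr_ge0 ?exprn_ge0.
Qed.

(** After substituting T^2 = 1/5 the difference of the two sides is affine in
T, so the irrational T may be replaced by 0.447 and 0.448, which bracket it.  In
x the difference is a cubic whose minimum on the relevant interval, about
0.035, is near 1.53; the two squares centred nearby certify its sign. *)
Lemma damping_cubic_endpoint x (T : R) :
  T ^+ 2 = 5^-1 -> 0 <= T -> 0 <= x -> 2 <= x ^+ 2 <= 3 ->
  2 * x * T * excess (x ^+ 2) (T ^+ 2) <=
  40^-1 * cube_tangent (gap x T) T.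
Proof.
move=> T2 T0 x0 xb; rewrite T2.
have Tb : 447 / 1000 <= T <= 448 / 1000 by apply/andP; split; nra.
have xb' : 141 / 100 <= x <= 174 / 100 by apply/andP; split; nra.
have h1 : 0 <= x * (x - 152 / 100) ^+ 2 by rewrite mulr_ge0// sqr_ge0.
have h2 := sqr_ge0 (x - 154 / 100).
pose Q (T : R) := 40^-1 * cube_tangent (3 - x ^+ 2 - 4 * 5^-1 + 2 * x * T) T
  - 2 * x * T * excess (x ^+ 2) 5^-1.
have Q1 : 0 <= Q (447 / 1000) by rewrite /Q; lra.
have Q2 : 0 <= Q (448 / 1000) by rewrite /Q; lra.
have QT : Q T = 1000 * ((448 / 1000 - T) * Q (447 / 1000) +
    (T - 447 / 1000) * Q (448 / 1000)).
  by rewrite /Q; field.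
rewrite -subr_ge0 -/(Q T) QT.
move: (Q (447 / 1000)) (Q (448 / 1000)) Q1 Q2 => a b a0 b0; clear Q QT h1 h2 T2.
by nra.
Qed.

(** In t the difference f of the two sides satisfies
T f(t) = (T - t) f(0) + t f(T) + T t (T - t) c with c >= 0 and T = 1/sqrt 5:
it lies above its chord, so only t = 0 and t = T need checking. *)
Lemma damping_cubic x t :
  0 <= t -> 5 * t ^+ 2 <= 1 -> 0 <= x -> 2 <= x ^+ 2 <= 3 ->
  2 * x * t * excess (x ^+ 2) (t ^+ 2) <=
  40^-1 * cube_tangent (gap x t) t.
Proof.
move=> t0 t2 x0 xb.
pose T : R := Num.sqrt 5^-1.
have T2 : T ^+ 2 = 5^-1 by rewrite sqr_sqrtr.
have T0 : 0 < T by rewrite sqrtr_gt0.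
have tT : t <= T by rewrite -(@ler_pXn2r _ 2)// ?nnegrE ?(ltW T0)// T2; lra.
have := @damping_cubic_endpoint x T T2 (ltW T0) x0 xb.
pose f (t : R) := 40^-1 * cube_tangent (gap x t) t
  - 2 * x * t * excess (x ^+ 2) (t ^+ 2).
rewrite -subr_ge0 -/(f T) => fT; rewrite -subr_ge0 -/(f t).
have f0 : 0 <= f 0 by rewrite /f; lra.
pose c := 3 * (13 / 5) ^+ 2 / 10 - x * (4 / 10 * (3 - x ^+ 2) + 512 / 1000) * (T + t) : R.
have Tb : T <= 448 / 1000 by nra.
have xb' : x <= 174 / 100 by nra.
have c0 : 0 <= c.
  rewrite /c.
  have : 0 <= x * (4 / 10 * (3 - x ^+ 2) + 512 / 1000) <= 2 by nra.
  move: (x * _) => y yb; nra.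
have fE : T * f t = (T - t) * f 0 + t * f T + T * (t * (T - t) * c) by rewrite /f /c; field.
rewrite -(pmulr_rge0 _ T0) fE.
move: c0; clear fE; clearbody c => d0; move: (f 0) (f T) c f0 fT d0 => a b d a0 b0 d0.
have p1 : 0 <= (T - t) * a by rewrite mulr_ge0 ?subr_ge0.
have p2 : 0 <= t * b by rewrite mulr_ge0.
have p3 : 0 <= T * (t * (T - t) * d).
  by rewrite (mulr_ge0 (ltW T0))// (mulr_ge0 _ d0)// mulr_ge0 ?subr_ge0.
by rewrite addr_ge0// addr_ge0.
Qed.

(** The term x^4 z / 5, quadratic in x^2, is first replaced by a linear function of
x^2, using (0.4 x^2 - 1)^2 >= 0; what remains is affine in x^2. *)
Lemma tilt_excess_factor_le x z : 0 <= z -> 5 * z <= 1 -> x ^+ 2 <= 3 ->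
  (1 - z) ^+ 2 * (1 - (1 - z) * (x ^+ 2 / 3 + (x ^+ 2) ^+ 2 * z / 5)) <=
  excess (x ^+ 2) z.
Proof.
move=> z0 z5; have := sqr_ge0 x; move: (x ^+ 2) => y y0 y3.
have h : 1 - (1 - z) * (y / 3 + y ^+ 2 * z / 5) <=
    (3 - y) / 3 * (1 + 14 / 10 * z) - 4 / 10 * z.
  (* This is the tangent of y^2 at y = 5/2, the middle of the interval [2, 3]. *)
  have : 0 <= z * (4 / 10 * y - 1) ^+ 2 by rewrite mulr_ge0// sqr_ge0.
  have : 0 <= z * y ^+ 2 * (1 / 5 - z) by rewrite mulr_ge0 ?mulr_ge0 ?sqr_ge0//; lra.
  lra.
apply: (le_trans (ler_wpM2l (sqr_ge0 _) h)).
have h2 : 0 <= (3 - y) * (z ^+ 2 * (18 / 10 - 14 / 10 * z)).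
  by rewrite mulr_ge0 ?subr_ge0// mulr_ge0 ?sqr_ge0//; lra.
have h3 : 0 <= z * ((1 - z) ^+ 2 - 64 / 100) by rewrite mulr_ge0//; nra.
by lra.
Qed.

(** Multiplied by 40 (1 - t^2)^3, the comparison of the excess of the tilt with
the drop of kappa becomes one between polynomials.  D(1) and D(-1) stand for
3 - A^2 and 3 - B^2 up to the factor 1 - t^2, and D(-1) is cut off at 0 because
kappa is zero beyond sqrt 3.  If it is cut off, the cube of D(1) is bounded below
by a tangent, which leads to [damping_cubic].  Otherwise D(1) = D(-1) + 4s, and
the difference of cubes is at least (4s)^3 = 64 s t^2 x^2, more than enough
because x^2 >= 2. *)
Lemma tilt_excess_cubes x t :
  0 <= t -> 5 * t ^+ 2 <= 1 -> 0 <= x -> 2 <= x ^+ 2 <= 3 ->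
  let D e := 3 - x ^+ 2 - 4 * t ^+ 2 + e * (2 * (x * t)) in
  0 <= D 1 /\
  80 * (x * t) * t ^+ 2 * ((1 - t ^+ 2) ^+ 2 *
     (1 - (1 - t ^+ 2) * (x ^+ 2 / 3 + (x ^+ 2) ^+ 2 * t ^+ 2 / 5))) <=
  D 1 ^+ 3 - Num.max 0 (D (-1)) ^+ 3.
Proof.
move=> t0 t5 x0 xb D.
have x2 : x ^+ 2 <= 3 by lra.
have := @tilt_excess_factor_le x (t ^+ 2) (sqr_ge0 t) t5 x2.
have := @damping_cubic x t t0 t5 x0 xb.
move: (_ ^+ 2 * (_ - _)) => E.
set U := _ - 256 / 1000 * _ => pU EU.
have s0 : 0 <= x * t by rewrite mulr_ge0.
have sz0 : 0 <= x * t * t ^+ 2 by rewrite mulr_ge0// sqr_ge0.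
have D0 : 0 <= D 1 by rewrite /D; nra.
split=> //; have [Dn|Dp] := leP (D (-1)) 0.
- rewrite expr0n subr0.
  apply: (@le_trans _ _ (t ^+ 2 * cube_tangent (D 1) t)).
    apply: (@le_trans _ _ (40 * t ^+ 2 * (2 * x * t * U))).
      have : x * t * t ^+ 2 * E <= x * t * t ^+ 2 * U by rewrite ler_wpM2l.
      by lra.
    have : t ^+ 2 * (2 * x * t * U) <= t ^+ 2 * (40^-1 * cube_tangent (D 1) t).
      rewrite ler_wpM2l ?sqr_ge0//; apply: (le_trans pU); rewrite /D; lra.
    by lra.
  (* The cube minus its tangent has the contact point as a double root. *)
  rewrite -subr_ge0; have -> : D 1 ^+ 3 - t ^+ 2 * cube_tangent (D 1) t =
    (D 1 - 13 / 5 * t) ^+ 2 * (D 1 + 26 / 5 * t) by field.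
  by rewrite mulr_ge0 ?sqr_ge0//; lra.
- have DD : D 1 = D (-1) + 4 * (x * t) by rewrite /D; ring.
  rewrite DD; move: (D (-1)) Dp => d d0.
  apply: (@le_trans _ _ (64 * (x * t) ^+ 3)); last first.
    rewrite -subr_ge0.
    have -> : (d + 4 * (x * t)) ^+ 3 - d ^+ 3 - 64 * (x * t) ^+ 3 =
      12 * (d * (x * t) * (d + 4 * (x * t))) by ring.
    have p1 := mulr_ge0 (ltW d0) s0.
    by rewrite mulr_ge0// mulr_ge0// addr_ge0 ?(ltW d0)// mulr_ge0.
  have U1 : U <= 1 by rewrite /U; have := sqr_ge0 t; nra.
  have -> : (x * t) ^+ 3 = x * t * t ^+ 2 * x ^+ 2 by ring.
  have : x * t * t ^+ 2 * E <= x * t * t ^+ 2 * 1 by rewrite ler_wpM2l// (le_trans EU).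
  have : x * t * t ^+ 2 * 2 <= x * t * t ^+ 2 * x ^+ 2 by rewrite ler_wpM2l//; lra.
  by lra.
Qed.

(** Below sqrt 3 the tilt w exceeds the artanh series, and the fall of kappa
from A to B covers twice the excess. *)
Lemma tilt_excess_le_kappa x t (th : R) :
  0 <= t -> 5 * t ^+ 2 <= 1 -> 0 <= x -> 2 <= x ^+ 2 <= 3 ->
  0 < th -> th ^+ 2 = 1 - t ^+ 2 ->
  2 * (x * t / (1 - t ^+ 2)) - 2 * artanh5 (x * t) <=
  kappa ((x - t) / th) - kappa ((x + t) / th).
Proof.
move=> t0 t5 x0 xb th0 th2.
have [D0 key] := tilt_excess_cubes x t t0 t5 x0 xb.
have z0 : 0 < 1 - t ^+ 2 by lra.
have s3 := @sqr_sqrtr R 3 ltac:(lra).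
have xt : t <= x by nra.
have kE (u : R) : 0 <= u -> kappa u = Num.max 0 (3 - u ^+ 2) ^+ 3 / 40.
  move=> u0; have [us|us] := leP u (Num.sqrt 3).
    by rewrite kappa_small// max_r// subr_ge0 -s3 ler_pXn2r// ?nnegrE ?sqrtr_ge0.
  rewrite kappa_large ?(ltW us)// max_l ?expr0n ?mul0r// subr_le0 -s3.
  by rewrite ler_pXn2r// ?nnegrE ?sqrtr_ge0// ltW.
have A0 : 0 <= (x - t) / th by rewrite divr_ge0 ?(ltW th0)// subr_ge0.
have B0 : 0 <= (x + t) / th by rewrite divr_ge0 ?(ltW th0)// addr_ge0.
rewrite !kE//.
have -> : 3 - ((x - t) / th) ^+ 2 =
    (3 - x ^+ 2 - 4 * t ^+ 2 + 1 * (2 * (x * t))) / (1 - t ^+ 2).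
  by rewrite exprMn exprVn th2; field; rewrite gt_eqF.
have -> : 3 - ((x + t) / th) ^+ 2 =
    (3 - x ^+ 2 - 4 * t ^+ 2 + -1 * (2 * (x * t))) / (1 - t ^+ 2).
  by rewrite exprMn exprVn th2; field; rewrite gt_eqF.
have maxD d : Num.max 0 (d / (1 - t ^+ 2)) = Num.max 0 d / (1 - t ^+ 2).
  by rewrite maxr_pMl ?mul0r// invr_ge0 ltW.
rewrite !maxD (max_r D0).
move: key; set a := _ + 1 * _; set b := Num.max _ _ => key.
rewrite -subr_ge0.
set E := 1 - _ in key.
have -> : (a / (1 - t ^+ 2)) ^+ 3 / 40 - (b / (1 - t ^+ 2)) ^+ 3 / 40 -
  (2 * (x * t / (1 - t ^+ 2)) - 2 * artanh5 (x * t)) =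
  (a ^+ 3 - b ^+ 3 - 80 * (x * t) * t ^+ 2 * ((1 - t ^+ 2) ^+ 2 * E)) /
  (40 * (1 - t ^+ 2) ^+ 3).
  by rewrite /E; field; rewrite gt_eqF.
by rewrite divr_ge0 ?subr_ge0// mulr_ge0// exprn_ge0// ltW.
Qed.
End poly.

(** * The two-point inequality *)

Section contract.
Context {R : realType}.
Implicit Types x t s : R.

(** The left point A is least at t = 1/x, where it equals sqrt (x^2 - 1).  If
x^2 >= 3 this is at least sqrt 2; if x^2 <= 3 the bound t^2 <= 1/5 keeps t
below 1/x, and the extreme case x = sqrt 2, t = 1/sqrt 5 gives 1.081.  This is
where 27/25 comes from. *)
Lemma left_point_ge x t (th : R) :
  0 <= t -> 0 < th -> th ^+ 2 = 1 - t ^+ 2 -> 0 <= x ->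
  2 <= x ^+ 2 -> (x ^+ 2 <= 3 -> 5 * t ^+ 2 <= 1) -> 27 / 25 <= (x - t) / th.
Proof.
move=> t0 th0 th2 x0 x2 t5.
have t1 : t <= 1 by have := exprn_gt0 2 th0; nra.
have xt : 0 <= x - t by nra.
rewrite ler_pdivlMr// -(@ler_pXn2r _ 2)// ?nnegrE ?mulr_ge0 ?(ltW th0)//.
rewrite exprMn th2.
have [x3|x3] := leP (x ^+ 2) 3.
  have t5' := t5 x3.
  have xb : 1414 / 1000 <= x by nra.
  have tb : t <= 4473 / 10000 by nra.
  nra.
have := sqr_ge0 (3 * t - x); nra.
Qed.

(** From exp(-v) >= 1 - v with v = b - a, since
1 - b <= (1 - a) (1 - (b - a)).  It turns a difference of the kappas into a
factor absorbing the exponential of the same size. *)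
Lemma onem_expR_le (a b : R) : 0 <= a -> a <= b -> b <= 1 ->
  (1 - b) * expR (b - a) <= 1 - a.
Proof.
move=> a0 ab b1.
have h : (1 - (b - a)) * expR (b - a) <= 1.
  have := expR_ge1Dx (- (b - a)); rewrite expRN.
  by rewrite -ler_pdivlMr ?expR_gt0// div1r.
apply: (@le_trans _ _ ((1 - a) * ((1 - (b - a)) * expR (b - a)))); last first.
  by rewrite -[leRHS]mulr1 ler_wpM2l//; lra.
rewrite mulrA ler_wpM2r ?(ltW (expR_gt0 _))//; nra.
Qed.

(** This is the sign of the derivative of profile(A) + profile(B).  If s = xt
is at least 1 the left side is nonpositive.  Otherwise phi(A) = phi(B) exp(2w),
and the exponential is split in two: exp(2 artanh5 s) turns 1 - s into at most
1 + s, and exp(2w - 2 artanh5 s) turns 1 - kappa(A) into at most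
1 - kappa(B). *)
Lemma weighted_density_le x t (th : R) :
  0 <= t -> 0 < th -> th ^+ 2 = 1 - t ^+ 2 -> 0 <= x ->
  2 <= x ^+ 2 -> (x ^+ 2 <= 3 -> 5 * t ^+ 2 <= 1) ->
  (1 - x * t) * ((1 - kappa ((x - t) / th)) * phi ((x - t) / th)) <=
  (1 + x * t) * ((1 - kappa ((x + t) / th)) * phi ((x + t) / th)).
Proof.
move=> t0 th0 th2 x0 x2 t5.
have A1 := left_point_ge x t th t0 th0 th2 x0 x2 t5.
have AB : (x - t) / th <= (x + t) / th by rewrite ler_pM2r ?invr_gt0//; lra.
have A0 : 0 <= (x - t) / th by lra.
have kA := kappa_le1 _ A1.
have kB := kappa_le1 _ (le_trans A1 AB).
have kAB := le_kappa _ _ A0 AB.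
have kB0 := kappa_ge0 _ (le_trans A0 AB).
have s0 : 0 <= x * t by rewrite mulr_ge0.
have t1 : t < 1 by have := exprn_gt0 2 th0; nra.
have z0 : 0 < 1 - t ^+ 2 by rewrite -th2 exprn_gt0.
have [s1|s1] := leP 1 (x * t).
  apply: (@le_trans _ _ 0).
    by rewrite mulr_le0_ge0 ?subr_le0// mulr_ge0 ?subr_ge0// ltW// phi_gt0.
  by rewrite mulr_ge0 ?addr_ge0// mulr_ge0 ?subr_ge0// ltW// phi_gt0.
set w := x * t / (1 - t ^+ 2).
set m := artanh5 (x * t).
have wm : 2 * w - 2 * m <= kappa ((x - t) / th) - kappa ((x + t) / th).
  have [x3|x3] := leP (x ^+ 2) 3.
    by apply: tilt_excess_le_kappa => //; [exact: t5|rewrite x2].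
  have := tilt_le_artanh x t (ltW x3) t0 t1 x0 (ltW s1); rewrite -/w -/m; lra.
have am : (1 - x * t) * expR (2 * m) <= 1 + x * t := expR_artanh_le _ s0 s1.
have -> : phi ((x - t) / th) = phi ((x + t) / th) * expR (2 * w).
  rewrite phi_expR [in RHS]phi_expR -mulrA -expRD; congr (_ * expR _).
  rewrite !exprMn !exprVn th2 /w; field; by rewrite gt_eqF.
have h := onem_expR_le _ _ kB0 kAB kA.
move: (kappa ((x - t) / th)) (kappa ((x + t) / th)) (phi _) (phi_gt0 ((x + t) / th))
  wm am h kA kB kAB kB0 => a b p p0 wm am h a1 b1 ba b0.
rewrite -/w; have -> : expR (2 * w) = expR (2 * m) * expR (2 * w - 2 * m).
  by rewrite -expRD; congr expR; ring.
have -> : (1 - x * t) * ((1 - a) * (p * (expR (2 * m) * expR (2 * w - 2 * m)))) =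
  p * (((1 - x * t) * expR (2 * m)) * ((1 - a) * expR (2 * w - 2 * m))) by ring.
have -> : (1 + x * t) * ((1 - b) * p) = p * ((1 + x * t) * (1 - b)) by ring.
rewrite ler_wpM2l ?(ltW p0)// ler_pM//.
- by rewrite mulr_ge0 ?expR_ge0// subr_ge0 ltW.
- by rewrite mulr_ge0 ?expR_ge0// subr_ge0.
- by apply: le_trans h; rewrite ler_wpM2l ?subr_ge0// ler_expR.
Qed.

(** With y = t / sqrt (1 - t^2) as parameter the two points are
x sqrt (1 + y^2) - y and x sqrt (1 + y^2) + y.  At y = 0 both are x, and
[weighted_density_le] says that the sum decreases in y. *)
Lemma profile_two_point x t : 0 <= t -> t < 1 -> 0 <= x -> 2 <= x ^+ 2 ->
  (x ^+ 2 <= 3 -> 5 * t ^+ 2 <= 1) ->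
  profile ((x - t) / Num.sqrt (1 - t ^+ 2)) + profile ((x + t) / Num.sqrt (1 - t ^+ 2)) <=
  2 * profile x.
Proof.
move=> t0 t1 x0 x2 t5.
have z0 : 0 < 1 - t ^+ 2 by nra.
pose th : R := Num.sqrt (1 - t ^+ 2).
have th0 : 0 < th by rewrite sqrtr_gt0.
have th2 : th ^+ 2 = 1 - t ^+ 2 by rewrite sqr_sqrtr// ltW.
pose c (y : R) : R := Num.sqrt (1 + y ^+ 2).
have cy (y : R) : 0 < 1 + y ^+ 2 by have := sqr_ge0 y; lra.
have c0 (y : R) : 0 < c y by rewrite sqrtr_gt0.
have c2 (y : R) : c y ^+ 2 = 1 + y ^+ 2 by rewrite sqr_sqrtr// ltW.
pose f (y : R) : R := - (profile (x * c y - y) + profile (x * c y + y)).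
have y0 : 0 <= t / th by rewrite divr_ge0// ltW.
(* c y is 1 / sqrt (1 - t'^2) for the smaller coefficient t' = y / c y. *)
suff : f 0 <= f (t / th).
  have cth : c (t / th) = th^-1.
    rewrite /c exprMn exprVn th2 (_ : 1 + _ = (th ^-1) ^+ 2); last first.
      by rewrite exprVn th2; field; rewrite gt_eqF.
    by rewrite sqrtr_sqr gtr0_norm// invr_gt0.
  rewrite /f cth /c expr0n addr0 sqrtr1 mulr1 subr0 addr0.
  rewrite -/th mulrBl mulrDl; lra.
pose A (y : R) : R := (x - y / c y) / (c y)^-1.
pose B (y : R) : R := (x + y / c y) / (c y)^-1.
apply: (@le_of_derive _ _ (fun y =>
  (1 + x * (y / c y)) * ((1 - kappa (B y)) * phi (B y)) -
  (1 - x * (y / c y)) * ((1 - kappa (A y)) * phi (A y))) _ _ y0).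
  move=> y _.
  have AE : x * c y - y = A y by rewrite /A; field; rewrite gt_eqF.
  have BE : x * c y + y = B y by rewrite /B; field; rewrite gt_eqF.
  have dc : is_derive y (1 : R) c (y / c y).
    have := is_derive1_sqrt (cy y) => ?; apply: is_derive_eq.
    rewrite /= /GRing.scale/= -/(c y); field; by rewrite gt_eqF.
  have dA : is_derive y (1 : R) (fun y => profile (x * c y - y))
      ((- (1 - kappa (A y)) * phi (A y)) * (x * (y / c y) - 1)).
    have dP := is_derive_profile (x * c y - y).
    have dg : is_derive y (1 : R) (fun y => x * c y - y) (x * (y / c y) - 1).
      by apply: is_derive_eq; rewrite /= /GRing.scale/=; ring.
    by rewrite -AE; exact: (@is_derive1_comp R profile (fun y => x * c y - y) y _ _ dP dg).
  have dB : is_derive y (1 : R) (fun y => profile (x * c y + y))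
      ((- (1 - kappa (B y)) * phi (B y)) * (x * (y / c y) + 1)).
    have dP := is_derive_profile (x * c y + y).
    have dg : is_derive y (1 : R) (fun y => x * c y + y) (x * (y / c y) + 1).
      by apply: is_derive_eq; rewrite /= /GRing.scale/=; ring.
    by rewrite -BE; exact: (@is_derive1_comp R profile (fun y => x * c y + y) y _ _ dP dg).
  rewrite /f; apply: is_derive_eq; rewrite /= /GRing.scale/=; ring.
move=> y /andP[yp yt]; rewrite subr_ge0.
have yc : 0 <= y / c y by rewrite divr_ge0 ?ltW.
have yc2 : (c y)^-1 ^+ 2 = 1 - (y / c y) ^+ 2.
  by rewrite exprMn exprVn c2; field; rewrite gt_eqF.
apply: weighted_density_le => //; first by rewrite invr_gt0.
move=> /t5 t5'; apply: le_trans t5'; rewrite ler_pM2l//.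
have y2 : y ^+ 2 * (1 - t ^+ 2) <= t ^+ 2.
  rewrite -ler_pdivlMr// -th2 -expr_div_n ler_pXn2r// ?nnegrE ?divr_ge0 ?(ltW th0)//; exact: ltW.
rewrite expr_div_n c2 ler_pdivrMr//; lra.
Qed.
End contract.

(** * Averages over signs *)

Section sign_mean.
Context {R : realType}.
Implicit Types (s : seq R) (f g : R -> R) (a x y : R).

(** The mean of f over the sums of the entries of s with all choices of signs.
The recursion moves the first entry into the function, so that conditioning on
one sign is a computation. *)
Fixpoint sign_mean s f : R :=
  if s is a :: s' then
    (sign_mean s' (fun y => f (y + a)) + sign_mean s' (fun y => f (y - a))) / 2
  else f 0.

Lemma eq_sign_mean s f g : f =1 g -> sign_mean s f = sign_mean s g.
Proof.
elim: s f g => [|a s IH] f g fg /=; first exact: fg.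
by congr ((_ + _) / _); apply: IH => y.
Qed.

Lemma le_sign_mean s f g : (forall y, f y <= g y) -> sign_mean s f <= sign_mean s g.
Proof.
elim: s f g => [|a s IH] f g fg /=; first exact: fg.
by rewrite ler_pM2r ?invr_gt0// lerD// IH.
Qed.

Lemma sign_mean_cst s a : sign_mean s (fun=> a) = a.
Proof. by elim: s => //= b s ->; field. Qed.

Lemma sign_meanD s f g : sign_mean s (fun y => f y + g y) = sign_mean s f + sign_mean s g.
Proof. by elim: s f g => //= a s IH f g; rewrite !IH; field. Qed.

Lemma sign_meanZ s a f : sign_mean s (fun y => a * f y) = a * sign_mean s f.
Proof. by elim: s f => //= b s IH f; rewrite !IH; field. Qed.

Lemma sign_mean_opp s f : sign_mean s (fun y => f (- y)) = sign_mean s f.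
Proof.
elim: s f => [|a s IH] f /=; first by rewrite oppr0.
rewrite -(IH (fun y => f (y + a))) -(IH (fun y => f (y - a))) addrC.
by congr ((_ + _) / _); apply: eq_sign_mean => y; rewrite opprD ?opprK.
Qed.

Lemma sign_mean_sqr s a : sign_mean s (fun y => (y + a) ^+ 2) = a ^+ 2 + \sum_(b <- s) b ^+ 2.
Proof.
elim: s a => [|b s IH] a /=; first by rewrite add0r big_nil addr0.
rewrite big_cons (@eq_sign_mean _ _ (fun y => (y + (b + a)) ^+ 2)); last first.
  by move=> y; rewrite addrA.
rewrite [X in _ + X](@eq_sign_mean _ _ (fun y => (y + (- b + a)) ^+ 2)); last first.
  by move=> y; rewrite addrA.
by rewrite !IH; field.
Qed.

Lemma sign_mean_swap a b s f : sign_mean [:: a, b & s] f = sign_mean [:: b, a & s] f.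
Proof.
rewrite /=; congr (_ / 2).
have swap u v : sign_mean s (fun y => f (y + u + v)) = sign_mean s (fun y => f (y + v + u)).
  by apply: eq_sign_mean => y; rewrite addrAC.
rewrite (swap b a) (swap (- b) a) (swap b (- a)) (swap (- b) (- a)).
by field.
Qed.

Lemma sign_mean_mid s1 a s2 f : sign_mean (s1 ++ a :: s2) f = sign_mean (a :: s1 ++ s2) f.
Proof.
elim: s1 f => //= b s1 IH f; rewrite !IH -[RHS]/(sign_mean [:: a, b & s1 ++ s2] f).
by rewrite sign_mean_swap.
Qed.

Lemma sign_mean_perm s1 s2 f : perm_eq s1 s2 -> sign_mean s1 f = sign_mean s2 f.
Proof.
elim: s1 s2 f => [|a s1 IH] s2 f p12.
  by move: p12; rewrite perm_sym => /perm_nilP ->.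
have as2 : a \in s2 by rewrite -(perm_mem p12) mem_head.
case/splitPr : as2 p12 => t1 t2.
rewrite perm_sym -(cat1s a t2) perm_catCA /= perm_cons perm_sym => p12.
by rewrite sign_mean_mid /=; congr ((_ + _) / _); exact: IH.
Qed.

Lemma sign_mean_norm s f : sign_mean [seq `|a| | a <- s] f = sign_mean s f.
Proof.
elim: s f => //= a s IH f; rewrite !IH.
have [a0|a0] := leP 0 a; first by rewrite ger0_norm.
rewrite ltr0_norm// addrC; congr ((_ + _) / _); apply: eq_sign_mean => y.
by rewrite opprK.
Qed.

Definition sign_tail s x := sign_mean s (fun y => (x <= y)%R%:R).

Lemma sign_tail_cons a s x :
  sign_tail (a :: s) x = (sign_tail s (x - a) + sign_tail s (x + a)) / 2.
Proof.
rewrite /sign_tail /=; congr ((_ + _) / _); apply: eq_sign_mean => y.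
  by rewrite lerBlDr.
by rewrite lerBrDr.
Qed.

Lemma sign_tail_nil x : sign_tail [::] x = (x <= 0)%R%:R.
Proof. by []. Qed.

Lemma le_sign_tail s x y : x <= y -> sign_tail s y <= sign_tail s x.
Proof.
move=> xy; apply: le_sign_mean => z; have [yz|//] := leP y z.
by rewrite (le_trans xy yz).
Qed.

Lemma sign_tail_le1 s x : sign_tail s x <= 1.
Proof. by rewrite -(sign_mean_cst s 1); apply: le_sign_mean => y; rewrite lern1 leq_b1. Qed.

(** By symmetry, twice the tail is the mean of the indicator of |S| >= x. *)
Lemma sign_tail_le_half s x : 0 < x -> sign_tail s x <= 1 / 2.
Proof.
move=> x0.
have : sign_tail s x + sign_tail s x <= 1.
  rewrite /sign_tail -{1}sign_mean_opp -sign_meanD -[leRHS](sign_mean_cst s 1).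
  apply: le_sign_mean => y.
  have [xy|_] := leP x (- y); last by rewrite add0r lern1 leq_b1.
  by have [xy'|_] := leP x y; [lra|rewrite addr0].
by lra.
Qed.

(** Symmetry gains a factor 2 over the usual inequality. *)
Lemma sign_tail_chebyshev s x : 0 < x ->
  sign_tail s x <= (\sum_(a <- s) a ^+ 2) * (2 * x ^+ 2)^-1.
Proof.
move=> x0.
have : sign_tail s x + sign_tail s x <= x ^- 2 * \sum_(a <- s) a ^+ 2.
  have := sign_mean_sqr s 0; rewrite expr0n add0r => <-.
  rewrite /sign_tail -{1}sign_mean_opp -sign_meanD -sign_meanZ; apply: le_sign_mean => y.
  rewrite addr0 mulrC ler_pdivlMr ?exprn_gt0//.
  have [xy|yx] := leP x (- y); have [xy'|yx'] := leP x y;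
    rewrite ?addr0 ?add0r ?mul1r ?mul0r ?sqr_ge0//; nra.
by rewrite invfM; lra.
Qed.

Lemma sign_tail_eq0 s x : all (>= 0) s -> \sum_(a <- s) a < x -> sign_tail s x = 0.
Proof.
elim: s x => [|a s IH] x /=.
  by rewrite big_nil sign_tail_nil => _ x0; rewrite leNgt x0.
move=> /andP[a0 s0]; rewrite big_cons sign_tail_cons => sx.
by rewrite !IH ?addr0 ?mul0r//; lra.
Qed.

(** Any sign pattern other than all plus has sum at most c + d - b, so only one
pattern out of eight can reach x. *)
Lemma sign_tail3_le (b c d x : R) : 0 <= b -> b <= c -> c <= d -> c + d - b < x ->
  sign_tail [:: b; c; d] x <= 1 / 8.
Proof.
move=> b0 bc cd xb; rewrite !sign_tail_cons !sign_tail_nil.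
have lt0 (y : R) : 0 < y -> (y <= 0)%R = false by move=> y0; rewrite leNgt y0.
rewrite (lt0 (x - b - c + d)); last lra.
rewrite (lt0 (x - b + c - d)); last lra.
rewrite (lt0 (x - b + c + d)); last lra.
rewrite (lt0 (x + b - c - d)); last lra.
rewrite (lt0 (x + b - c + d)); last lra.
rewrite (lt0 (x + b + c - d)); last lra.
rewrite (lt0 (x + b + c + d)); last lra.
by case: (_ <= 0)%R => /=; lra.
Qed.

(** The two largest coefficients satisfy (c + d)^2 <= 2 (c^2 + d^2) < x^2.
Hence one or two coefficients cannot reach x; three do so at most when all signs
are plus; and with four, fixing the sign of the smallest, a, leaves the
previous situation at level x - a, because c + d - b < x - a as a <= b. *)
Lemma sign_tail_le_eighth s x : all (>= 0) s -> sorted <=%R s -> (size s <= 4)%N ->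
  0 < x -> 2 * \sum_(a <- s) a ^+ 2 < x ^+ 2 -> sign_tail s x <= 1 / 8.
Proof.
move=> s0 sS s4 x0 sx.
have pair (c d : R) : 0 <= c -> 0 <= d ->
    c ^+ 2 + d ^+ 2 <= \sum_(a <- s) a ^+ 2 -> c + d < x.
  move=> c0 d0 h; rewrite -(@ltr_pXn2r _ 2)// ?nnegrE ?addr_ge0// ?(ltW x0)//.
  have := sqr_ge0 (c - d); nra.
case: s s0 sS s4 sx pair => [|a [|b [|c [|d [|]]]]] //=.
- by move=> *; rewrite sign_tail_nil [(x <= 0)%R]leNgt x0 /=; lra.
- rewrite !big_cons !big_nil !andbT => a0 _ _ sx pair.
  rewrite sign_tail_eq0 ?divr_ge0//= ?a0// big_cons big_nil.
  by apply: pair; rewrite ?expr0n.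
- rewrite !big_cons !big_nil !andbT => /andP[a0 b0] _ _ sx pair.
  rewrite sign_tail_eq0 ?divr_ge0//= ?a0 ?b0// !big_cons big_nil.
  by rewrite addr0; apply: pair; rewrite ?addr0.
- rewrite !big_cons !big_nil !andbT => /and3P[a0 b0 c0] /andP[ab bc] _ sx pair.
  have bcx : b + c < x by apply: pair; rewrite // addr0 lerDr sqr_ge0.
  by apply: sign_tail3_le => //; lra.
- rewrite !big_cons !big_nil !andbT => /and4P[a0 b0 c0 d0] /and3P[ab bc cd] _ sx pair.
  have cdx : c + d < x.
    by apply: pair => //; rewrite addr0 addrA lerDr addr_ge0// sqr_ge0.
  rewrite sign_tail_cons.
  have : sign_tail [:: b; c; d] (x - a) <= 1 / 8 by apply: sign_tail3_le => //; lra.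
  have : sign_tail [:: b; c; d] (x + a) <= sign_tail [:: b; c; d] (x - a).
    by apply: le_sign_tail; lra.
  by lra.
Qed.

(** Induction on the number of coefficients, stated for an arbitrary total
sg^2 so that removing a coefficient needs no renormalisation.  Up to sqrt 2
Chebyshev's bound is enough; with at most four coefficients and u <= sqrt 3 the
tail is at most 1/8; in all other cases the smallest coefficient is split off,
the induction hypothesis is applied at the two new points, both at least 27/25,
and [profile_two_point] combines them. *)
Lemma sign_tail_le_profile s (sg u : R) : all (>= 0) s -> sorted <=%R s ->
  0 < sg -> \sum_(a <- s) a ^+ 2 = sg ^+ 2 -> 27 / 25 <= u ->
  sign_tail s (sg * u) <= c2 R * profile u.
Proof.
elim: s sg u => [|a s IH] sg u.
  by rewrite big_nil => _ _ sg0 sg2; have := exprn_gt0 2 sg0; rewrite -sg2 ltxx.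
move=> s0 sS sg0 sgE u1.
have K0 : 0 < c2 R by have := @c2_bounds R; lra.
have su0 : 0 < sg * u by rewrite mulr_gt0//; lra.
have [u2|u2] := leP u (Num.sqrt 2).
  apply: (le_trans (sign_tail_chebyshev _ _ su0)).
  apply: le_trans (chebyshev_le_profile _ _); last by rewrite u1.
  rewrite sgE exprMn mulrCA invfM mulrA divff ?mul1r//.
  by rewrite gt_eqF// exprn_gt0.
have uu : 2 < u ^+ 2.
  by rewrite -(@sqr_sqrtr _ 2)// ltr_pXn2r// ?nnegrE ?sqrtr_ge0//; lra.
have u0 : 0 <= u by lra.
have [/andP[u3 s4]|big] := boolP ((u <= Num.sqrt 3) && (size (a :: s) <= 4)%N).
  apply: (@le_trans _ _ (1 / 8)).
    apply: sign_tail_le_eighth => //; rewrite sgE exprMn mulrC ltr_pM2l// exprn_gt0//.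
  apply: (@le_trans _ _ (c2 R * profile (Num.sqrt 3))).
    rewrite profile_large//; have := @Phibar_sqrt3 R; have := @c2_bounds R; nra.
  by rewrite ler_pM2l// le_profile.
have amin : all (>= a) s by move: sS => /= /(order_path_min le_trans).
have /andP[a0 s0'] : (0 <= a) && all (>= 0) s := s0.
(* The smallest square is at most the average of the squares. *)
have sizeb : (size s)%:R * a ^+ 2 <= \sum_(b <- s) b ^+ 2.
  elim: s amin {IH s0 sS sgE big s0'} => [|b s IH] /=; first by rewrite mul0r big_nil.
  move=> /andP[ab /IH]; rewrite big_cons -natr1 mulrDl mul1r addrC => h.
  by rewrite lerD// ler_pXn2r// ?nnegrE// (le_trans a0).
(* With a single coefficient sg, the sum never reaches sg u > sg. *)
have [s_nil|s_cons] := posnP (size s).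
  have us : Num.sqrt 3 <= u.
    by move: big; rewrite /= s_nil andbT -ltNge => /ltW.
  rewrite sign_tail_eq0//; first by rewrite profile_large// mulr_ge0// ltW// Phibar_gt0.
  move/size0nil : s_nil sgE => ->; rewrite !big_cons !big_nil !addr0 => /eqP.
  by rewrite eqrXn2 ?(ltW sg0)// => /eqP ->; nra.
pose t := a / sg.
have t0 : 0 <= t by rewrite divr_ge0// ltW.
have at_ : a = sg * t by rewrite /t mulrC divfK// gt_eqF.
have sgE' : \sum_(b <- s) b ^+ 2 = sg ^+ 2 * (1 - t ^+ 2).
  by move: sgE; rewrite big_cons at_ exprMn; lra.
have nt : (size s).+1%:R * t ^+ 2 <= 1.
  move: sizeb; rewrite sgE' at_ exprMn mulrCA ler_pM2l ?exprn_gt0//.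
  by rewrite -natr1 mulrDl mul1r; lra.
have t5 : u ^+ 2 <= 3 -> 5 * t ^+ 2 <= 1.
  move=> u3; apply: le_trans nt; rewrite ler_wpM2r ?sqr_ge0// ler_nat ltnNge.
  move: big; rewrite negb_and -ltNge => /orP[|//]; rewrite ltNge => /negP[].
  by rewrite -(@ler_pXn2r _ 2)// ?nnegrE ?sqrtr_ge0// sqr_sqrtr.
have t1 : t < 1.
  have : 2 * t ^+ 2 <= 1.
    by apply: le_trans nt; rewrite ler_wpM2r ?sqr_ge0// ler_nat.
  by nra.
have z0 : 0 < 1 - t ^+ 2 by nra.
pose th : R := Num.sqrt (1 - t ^+ 2).
have th0 : 0 < th by rewrite sqrtr_gt0.
have th2 : th ^+ 2 = 1 - t ^+ 2 by rewrite sqr_sqrtr// ltW.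
have uu' := ltW uu.
have A1 := left_point_ge u t th t0 th0 th2 u0 uu' t5.
have B1 : 27 / 25 <= (u + t) / th.
  by apply: (le_trans A1); rewrite ler_pM2r ?invr_gt0//; lra.
have sS' : sorted <=%R s by exact: path_sorted sS.
have sgth0 : 0 < sg * th by rewrite mulr_gt0.
have sgth : \sum_(b <- s) b ^+ 2 = (sg * th) ^+ 2 by rewrite exprMn th2.
have := IH _ _ s0' sS' sgth0 sgth A1; have := IH _ _ s0' sS' sgth0 sgth B1.
have -> : sg * th * ((u - t) / th) = sg * u - a by rewrite at_; field; rewrite gt_eqF.
have -> : sg * th * ((u + t) / th) = sg * u + a by rewrite at_; field; rewrite gt_eqF.
rewrite sign_tail_cons => hB hA.
have := profile_two_point u t t0 t1 u0 uu' t5; rewrite -/th -(ler_pM2l K0) mulrDr; lra.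
Qed.

Lemma sign_tail_le_Phibar s x : \sum_(a <- s) a ^+ 2 = 1 -> sign_tail s x <= c2 R * Phibar x.
Proof.
move=> sE; have K := @c2_bounds R.
have [x0|x0] := leP x 0.
  apply: (le_trans (sign_tail_le1 s x)).
  by have := le_Phibar _ _ x0; rewrite Phibar0; nra.
have [x1|x1] := leP x 1.
  apply: (le_trans (sign_tail_le_half s x x0)).
  have := @chebyshev_le_Phibar R 1; rewrite expr1n lexx mulr1 => h1.
  have : 1 <= (Num.sqrt 2 : R) by have := @sqrt2_bounds R; lra.
  by move=> /h1; have := le_Phibar _ _ x1; nra.
have [x2|x2] := leP x (Num.sqrt 2).
  apply: (le_trans (sign_tail_chebyshev s x x0)).
  by rewrite sE mul1r chebyshev_le_Phibar// x2 ltW.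
have xb : 27 / 25 <= x by have := @sqrt2_bounds R; lra.
apply: (@le_trans _ _ (c2 R * profile x)); last first.
  by rewrite ler_pM2l ?le_profile_Phibar//; lra.
pose s' := sort <=%R [seq `|a| | a <- s].
have -> : sign_tail s x = sign_tail s' (1 * x).
  rewrite mul1r /sign_tail -sign_mean_norm; apply: sign_mean_perm.
  by rewrite perm_sym perm_sort.
apply: sign_tail_le_profile => //.
- by rewrite all_sort; apply/allP => _ /mapP[a _ ->].
- exact: sort_le_sorted.
- rewrite (perm_big [seq `|a| | a <- s]) ?perm_sort// big_map.
  by rewrite expr1n -[RHS]sE; apply: eq_bigr => a _; rewrite real_normK// num_real.
Qed.
End sign_mean.

(** * The law of a Rademacher sum *)

Section law.
Context {R : realType} {d : measure_display} {T : measurableType d}.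
Context (P : probability T R) (n : nat) (eps : 'I_n -> {RV P >-> R}) (a : 'I_n -> R).
Hypothesis eps_indep : mutually_independent eps.
Hypothesis eps_rademacher : forall i, rademacher (eps i).

Definition signs (J : {set 'I_n}) (sgn : 'I_n -> R) : set T :=
  \bigcap_(j in [set` J]) (eps j @^-1` [set sgn j]).

Lemma measurable_eps i A : measurable A -> measurable (eps i @^-1` A).
Proof. by move=> mA; rewrite -[X in measurable X]setTI; exact: measurable_funPT. Qed.

Lemma measurable_signs J sgn : measurable (signs J sgn).
Proof.
apply: fin_bigcap_measurable => [|j _]; first exact: finite_finset.
exact: measurable_eps.
Qed.

(** The variables indexed by r are the ones whose signs are still free; the
others are accounted for by y. *)
Definition upper (r : seq 'I_n) (x y : R) : set T :=
  [set w | x <= y + \sum_(i <- r) a i * eps i w].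

Lemma measurable_upper r x y : measurable (upper r x y).
Proof.
have mf : measurable_fun setT (fun w => y + \sum_(i <- r) a i * eps i w).
  apply: measurable_funD; first exact: measurable_cst.
  apply: measurable_sum => i; apply: measurable_funM; first exact: measurable_cst.
  exact: measurable_funPT.
have := mf measurableT (`[x, +oo[%classic : set R) (measurable_itv _); rewrite setTI.
congr (measurable _); apply/seteqP; split => w /=; rewrite in_itv/= andbT//.
Qed.

Lemma prob_signs (J : {set 'I_n}) (sgn : 'I_n -> R) : (forall j, j \in J -> `|sgn j| = 1) ->
  P (signs J sgn) = (2^-1 ^+ #|J|)%:E.
Proof.
move=> sgn1; rewrite /signs (eps_indep J (fun j => [set sgn j])); last first.
  by move=> i _; exact: measurable_set1.
rewrite (eq_bigr (fun=> (2^-1)%:E)) => [|j jJ].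
  by rewrite prodEFin prodr_const.
have [h1 h2] := eps_rademacher j.
have := sgn1 j jJ; have [s0|s0] := leP 0 (sgn j); first by rewrite ger0_norm// => ->.
by rewrite ltr0_norm// => e; rewrite -[sgn j]opprK e.
Qed.

(** The two atoms have total mass 1, so the values other than 1 and -1 are
negligible; the variables need not take values in {1, -1} everywhere. *)
Lemma prob_not_sign i : P (~` (eps i @^-1` [set 1] `|` eps i @^-1` [set -1])) = 0%E.
Proof.
have m1 : measurable (eps i @^-1` [set 1]) by exact: measurable_eps.
have m2 : measurable (eps i @^-1` [set -1]) by exact: measurable_eps.
rewrite probability_setC; last exact: measurableU.
rewrite measureU//.
  have [h1 h2] := eps_rademacher i.
  have -> : (P (eps i @^-1` [set 1%R]) + P (eps i @^-1` [set (-1)%R]) = 1)%E.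
    by rewrite [X in (X + _)%E]h1 [X in (_ + X)%E]h2 -EFinD; congr EFin; lra.
  by rewrite subee.
apply/seteqP; split => // w [/= -> /eqP].
by rewrite -subr_eq0 opprK paddr_eq0// oner_eq0.
Qed.

(** The signs in J are already fixed, and contribute to the offset y.  Each step
covers the event by the two events in which one more sign is fixed and a null
set.  Independence is used only at the end, for the probability of a full sign
pattern. *)
Lemma prob_signs_upper_le r (J : {set 'I_n}) (sgn : 'I_n -> R) (x y : R) :
  uniq r -> (forall i, i \in r -> i \notin J) -> (forall j, j \in J -> `|sgn j| = 1) ->
  (P (signs J sgn `&` upper r x y) <=
   (2^-1 ^+ #|J| * sign_tail (map a r) (x - y))%:E)%E.
Proof.
elim: r J sgn y => [|i r IH] J sgn y.
  move=> _ _ sgn1; rewrite sign_tail_nil subr_le0.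
  have [xy|yx] := leP x y.
    rewrite mulr1 -(prob_signs _ _ sgn1) le_measure ?inE//.
    - by apply: measurableI; [exact: measurable_signs|exact: measurable_upper].
    - exact: measurable_signs.
  rewrite mulr0 (_ : _ `&` _ = set0) ?measure0//.
  by apply/seteqP; split => // w [_]; rewrite /upper /= big_nil addr0 leNgt yx.
move=> /= /andP[ir ur] rJ sgn1.
pose sg (e : R) j := if j == i then e else sgn j.
have step (e : R) : `|e| = 1 ->
    (P (signs (i |: J) (sg e) `&` upper r x (y + a i * e)) <=
     (2^-1 ^+ #|J| * sign_tail (map a r) (x - y - a i * e) / 2)%:E)%E.
  move=> e1.
  have -> : 2^-1 ^+ #|J| * sign_tail (map a r) (x - y - a i * e) / 2 =
      2^-1 ^+ #|i |: J| * sign_tail (map a r) (x - (y + a i * e)).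
    rewrite cardsU1 (rJ i (mem_head _ _)) exprS opprD addrA; ring.
  apply: IH => // [j jr|j].
    rewrite !inE negb_or rJ ?inE ?jr ?orbT// andbT.
    by apply: contraNneq ir => <-.
  by rewrite !inE /sg; case: eqP => //= _ jJ; exact: sgn1.
set E := signs J sgn `&` _.
set E1 := signs (i |: J) (sg 1) `&` upper r x (y + a i * 1).
set E2 := signs (i |: J) (sg (-1)) `&` upper r x (y + a i * -1).
set N := ~` (eps i @^-1` [set 1] `|` eps i @^-1` [set -1]).
have mI J' sgn' y' r' : measurable (signs J' sgn' `&` upper r' x y').
  by apply: measurableI; [exact: measurable_signs|exact: measurable_upper].
have mE1 : measurable E1 := mI _ _ _ _.
have mE2 : measurable E2 := mI _ _ _ _.
have mE : measurable E := mI _ _ _ _.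
have mN : measurable N by apply: measurableC; apply: measurableU; exact: measurable_eps.
have cover : E `<=` (E1 `|` E2) `|` N.
  move=> w [ws]; rewrite /upper /= big_cons => wx.
  have signsP e : eps i w = e -> signs (i |: J) (sg e) w.
    move=> we j /=; rewrite !inE /sg; case: eqP => [-> _ //|_ /= jJ]; exact: ws.
  have [we|w1] := eqVneq (eps i w) 1.
    by left; left; split; [exact: signsP|rewrite /upper /= -we -addrA].
  have [we|w2] := eqVneq (eps i w) (-1).
    by left; right; split; [exact: signsP|rewrite /upper /= -we -addrA].
  by right => -[/=|/=] /eqP; apply/negP.
apply: (@le_trans _ _ (P ((E1 `|` E2) `|` N))).
  by rewrite le_measure ?inE//; apply: measurableU => //; exact: measurableU.
apply: (le_trans (measureU2 _ _ _)) => //; first exact: measurableU.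
rewrite [X in (_ + X)%E](prob_not_sign i) adde0.
apply: (le_trans (measureU2 _ _ _)) => //.
have h1 := step 1 (normr1 _); have h2 := step (-1) ltac:(by rewrite normrN1).
apply: (le_trans (leeD h1 h2)).
rewrite -EFinD lee_fin sign_tail_cons mulr1 mulrN1 opprK; lra.
Qed.

Lemma prob_upper_le x :
  fine (P [set w | x <= \sum_(i < n) a i * eps i w]) <=
  sign_tail [seq a i | i <- enum 'I_n] x.
Proof.
have := @prob_signs_upper_le (enum 'I_n) finset.set0 (fun=> 1) x 0 (enum_uniq _).
have -> : signs finset.set0 (fun=> 1) = setT.
  by apply/seteqP; split => // w _ j /=; rewrite inE.
rewrite setTI cards0 mul1r subr0 => h.
have {h} := h _ _; set E := upper _ _ _.
have -> : [set w | x <= \sum_(i < n) a i * eps i w] = E.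
  by rewrite /E; apply/seteqP; split => w /=; rewrite /upper /= add0r big_enum.
move=> h; rewrite -lee_fin fineK ?fin_num_measure//; last exact: measurable_upper.
by apply: h => [i|j]; rewrite inE.
Qed.
End law.

(** * Two fair coins *)

Section coins.
Context {R : realType}.

Definition coin_sign (b : bool) : R := if b then 1 else -1.

Definition coin (i : 'I_2) (w : bool * bool) : R :=
  coin_sign (if i == ord0 then w.1 else w.2).

Lemma measurable_coin i : measurable_fun setT (coin i).
Proof.
rewrite /coin; case: (i == ord0); apply: (@measurableT_comp _ _ _ _ _ _ coin_sign) => //.
Qed.

HB.instance Definition _ i := isMeasurableFun.Build _ _ _ _ (coin i) (measurable_coin i).

Definition two_coins := (bernoulli_prob (2^-1 : R) \x bernoulli_prob (2^-1 : R))%E.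

Lemma two_coinsX (A B : set bool) :
  two_coins (A `*` B) = (bernoulli_prob (2^-1 : R) A * bernoulli_prob (2^-1 : R) B)%E.
Proof. by rewrite /two_coins product_measure1E. Qed.

Lemma two_coins_coin (i : 'I_2) (A : set R) :
  two_coins (coin i @^-1` A) = bernoulli_prob 2^-1 (coin_sign @^-1` A).
Proof.
rewrite /coin; case: (i == ord0).
  rewrite (_ : _ @^-1` _ = (coin_sign @^-1` A) `*` setT); last first.
    by apply/seteqP; split => [w /=|w []].
  by rewrite two_coinsX [X in (_ * X)%E]probability_setT mule1.
rewrite (_ : _ @^-1` _ = setT `*` (coin_sign @^-1` A)); last first.
  by apply/seteqP; split => [w /=|w []].
by rewrite two_coinsX [X in (X * _)%E]probability_setT mul1e.
Qed.

(** The joint event is a rectangle in which an index missing from J contributes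
the whole factor, of mass 1. *)
Lemma coin_indep : @mutually_independent R _ _ two_coins 2 coin.
Proof.
move=> J A mA.
pose B k := if k \in J then coin_sign @^-1` (A k) else setT.
have -> : \bigcap_(i in [set` J]) (coin i @^-1` A i) = B ord0 `*` B ord_max.
  apply/seteqP; split => [w wA|w [w0 w1] i /= iJ].
    by split; rewrite /B; case: ifPn => // kJ; exact: (wA _ kJ).
  case: (unliftP ord0 i) iJ => [j|] -> iJ.
    rewrite (ord1 j) in iJ *; rewrite (_ : lift _ _ = ord_max) in iJ *; last exact/val_inj.
    by move: w1; rewrite /B iJ.
  by move: w0; rewrite /B iJ.
rewrite [LHS]two_coinsX big_mkcond big_ord_recl big_ord1.
rewrite (_ : lift ord0 ord0 = ord_max); last exact/val_inj.
have bB k : bernoulli_prob (2^-1 : R) (B k) =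
    if k \in J then two_coins (coin k @^-1` A k) else 1%E.
  rewrite /B; case: ifPn => _; last exact: probability_setT.
  by rewrite [RHS]two_coins_coin.
by rewrite !bB.
Qed.

Lemma coin_rademacher i : @rademacher R _ _ two_coins (coin i).
Proof.
have n11 : (1 : R) != -1 by rewrite -subr_eq0 opprK paddr_eq0// oner_eq0.
have b01 : 0 <= (2^-1 : R) <= 1 by lra.
split; rewrite [LHS]two_coins_coin bernoulli_probE ?diracE//.
  rewrite mem_set//= memNset/=; last by move=> /eqP; rewrite eq_sym (negbTE n11).
  by rewrite mule0 adde0 mule1.
rewrite memNset/=; last by move=> /eqP; rewrite (negbTE n11).
rewrite mem_set//= mule0 add0e mule1; congr EFin; rewrite /unstable.onem; lra.
Qed.

(** The product of two fair Bernoulli laws realises two independent signs.  With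
coefficients 1/sqrt 2 their sum reaches sqrt 2 when both are heads. *)
Lemma dominating_ge_c1 (c : R) : dominating_constant c -> c1 R <= c.
Proof.
move=> cdom.
have s2 : 0 < (Num.sqrt 2 : R) by rewrite sqrtr_gt0.
pose a (i : 'I_2) : R := (Num.sqrt 2)^-1.
have a1 : \sum_(i < 2) a i ^+ 2 = 1.
  by rewrite !big_ord_recl big_ord0 /a exprVn sqr_sqrtr//; lra.
have := cdom 2 a isT a1 _ _ two_coins coin coin_indep coin_rademacher (Num.sqrt 2).
set E := [set w | _] => h.
rewrite /c1 ler_pdivrMr ?mulr_gt0 ?Phibar_gt0//.
suff : 1 / 4 <= fine (two_coins E) by move: (Phibar _) h => p; lra.
have mE : measurable E.
  have := measurable_upper two_coins 2 coin a (enum 'I_2) (Num.sqrt 2) 0.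
  congr (measurable _); apply/seteqP; split => w; rewrite /upper /E /= add0r big_enum//.
rewrite -lee_fin fineK; last first.
  by rewrite ge0_fin_numE ?measure_ge0// (le_lt_trans (probability_le1 two_coins mE))// ltry.
apply: (@le_trans _ _ (two_coins ([set true] `*` [set true]))).
  rewrite two_coinsX bernoulli_probE ?diracE; last lra.
  rewrite mem_set//= memNset//= mule0 adde0 mule1 -EFinM lee_fin; lra.
rewrite le_measure ?inE//; first exact: measurableX.
move=> w [/= w1 w2]; rewrite /E /= !big_ord_recl big_ord0 /coin /= w1 w2 /= /a !mulr1 addr0.
have -> : (Num.sqrt 2 : R)^-1 = Num.sqrt 2 / 2; last by lra.
apply: (mulfI (lt0r_neq0 s2)); rewrite divff ?lt0r_neq0// mulrA -expr2 sqr_sqrtr//.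
by rewrite divff.
Qed.
End coins.

(** * The least dominating constant *)

Section main.
Context {R : realType}.

Lemma c2_dominating : dominating_constant (c2 R).
Proof.
move=> n a n0 a1 d T P eps indep rade x.
apply: (le_trans (prob_upper_le P n eps a indep rade x)).
by apply: sign_tail_le_Phibar; rewrite big_map big_enum.
Qed.
End main.

Theorem theorem1 (R : realType) :
  (exists cstar : R,
     [/\ dominating_constant cstar,
         (forall c : R, dominating_constant c -> cstar <= c) &
         c1 R <= cstar <= c2 R]) /\
  [/\ `|c1 R - 318 / 100| < 5 / 1000,
      `|c2 R - 322 / 100| < 5 / 1000 &
      `|c2 R / c1 R - 101 / 100| < 5 / 1000].
Proof.
split; last first.
  have := @c1_bounds R; have := @c2_bounds R; have := @inv_mills_bounds R => r K c.
  have c0 := @c1_gt0 R.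
  split; rewrite ltr_norml; [lra|lra|].
  rewrite /c2 mulrAC divff ?gt_eqF// mul1r; lra.
pose D : set R := [set c | dominating_constant c].
have D0 : D !=set0 by exists (c2 R); exact: c2_dominating.
have Dlb : lbound D (c1 R) by move=> c; exact: dominating_ge_c1.
exists (inf D); split.
(* Each tail bounds every dominating constant below once divided by Phibar x > 0. *)
- move=> n a n0 a1 d T P eps indep rade x.
  rewrite -ler_pdivrMr ?Phibar_gt0//; apply: lb_le_inf => // c Dc.
  by rewrite ler_pdivrMr ?Phibar_gt0//; exact: Dc.
- by move=> c Dc; apply: ge_inf => //; exists (c1 R).
- by rewrite lb_le_inf//= ge_inf//; [exists (c1 R)|exact: c2_dominating].
Qed.
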